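(* Let $A\in\mathbb{R}^{d\times n}_{\geq 0}$ be a nonnegative matrix of rank $d$ with no zero column, let $B\in\mathbb{R}^{n\times(n-d)}$ be a matrix whose columns form a basis of $\ker A$, and for $b\in\mathrm{pos}(A)$ put $P_b=\{x\in\mathbb{R}^n_{\geq 0}: Ax=b\}$ and $Q_b=B^T\cdot P_b\subset\mathbb{R}^{n-d}$. Let $C\in\mathcal{C}_A$ be a cell of the chamber complex of $A$, and let $n_C$ be the number of facets of $P_b$ for $b\in\mathrm{int}(C)$. Then the function $$f(b,y)=\mathrm{vol}_{n-d}\,(Q_b-y)^\circ$$ is a homogeneous rational function (jointly in $(b,y)$) of degree $d-n$ on the set $$\{(b,y)\in\mathbb{R}^d\times\mathbb{R}^{n-d} : b\in C\cap\mathrm{pos}(A),\ y\in\mathrm{int}(Q_b)\}.$$ Its numerator has degree $d-n+n_C$ and its denominator has degree $n_C$.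
   Context: $\mathrm{pos}(A)$ is the image of $\mathbb{R}^n_{>0}$ under $A:\mathbb{R}^n\to\mathbb{R}^d$; it is the interior of $\mathrm{cone}(A)$, the convex cone generated by the columns of $A$. For $b\in\mathrm{pos}(A)$, $P_b$ is an $(n-d)$-dimensional polytope and $Q_b$ is a full-dimensional polytope in $\mathbb{R}^{n-d}$. Dual polytope: for a full-dimensional polytope $Q\subset\mathbb{R}^m$ and $y\in\mathrm{int}(Q)$, $(Q-y)^\circ=\{z\in(\mathbb{R}^m)^\vee:\langle y'-y,z\rangle\leq 1\text{ for all }y'\in Q\}$. $\mathrm{vol}_m$ is $m$-dimensional Lebesgue volume. Chamber complex: for $\emptyset\neq\sigma\subset[n]=\{1,\dots,n\}$ let $A_\sigma$ be the submatrix of $A$ with columns indexed by $\sigma$. For $b\in\mathrm{cone}(A)$ the chamber of $b$ is $C_b=\bigcap_{\sigma:\,b\in\mathrm{cone}(A_\sigma)}\mathrm{cone}(A_\sigma)$, and $\mathcal{C}_A=\{C_b: b\in\mathrm{cone}(A)\}$. A cell is a full-dimensional ($d$-dimensional) chamber. For $b$ in the interior of a cell $C$, the polytope $P_b$ is simple and its combinatorial type does not depend on $b\in\mathrm{int}(C)$, so $n_C$ is well defined. *)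

(* Defs.v *)
From HB Require Import structures.
From mathcomp Require Import all_boot all_order all_algebra.
From mathcomp Require Import all_classical all_reals all_analysis.
(* The notations of mpoly clash with those of mathcomp-analysis. *)
From mathcomp Require Import -(notations) mpoly.

Set Implicit Arguments.
Unset Strict Implicit.
Unset Printing Implicit Defensive.

Import Order.TTheory GRing.Theory Num.Theory.
Import numFieldNormedType.Exports.

Local Open Scope classical_set_scope.
Local Open Scope ring_scope.

Section cones_and_chambers.
Context {R : realType} {d n : nat}.

Definition nonneg_orthant k : set 'cV[R]_k := [set x | forall i, 0 <= x i 0].

Definition pos_orthant k : set 'cV[R]_k := [set x | forall i, 0 < x i 0].

Definition cone k (A : 'M[R]_(d, k)) : set 'cV[R]_d :=
  mulmx A @` @nonneg_orthant k.

Definition pos k (A : 'M[R]_(d, k)) : set 'cV[R]_d :=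
  mulmx A @` @pos_orthant k.

Definition colset (A : 'M[R]_(d, n)) (s : {set 'I_n}) : 'M[R]_(d, #|s|) :=
  colsub (fun k : 'I_#|s| => enum_val k) A.

Definition chamber (A : 'M[R]_(d, n)) (b : 'cV[R]_d) : set 'cV[R]_d :=
  \bigcap_(s in [set s : {set 'I_n} |
                  s != finset.set0 /\ cone (colset A s) b]) cone (colset A s).

Definition chamber_complex (A : 'M[R]_(d, n)) : set (set 'cV[R]_d) :=
  chamber A @` cone A.

End cones_and_chambers.

Section dimension_and_facets.
Context {R : realType} {k : nat}.

(* The direction of the affine hull of S, i.e. the linear span of the
   differences of points of S, is U. *)
Definition has_direction (S : set 'cV[R]_k) (U : {vspace 'cV[R]_k}) : Prop :=
  forall V : {vspace 'cV[R]_k},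
    (U <= V)%VS <-> (forall x y, S x -> S y -> x - y \in V).

(* No number is the dimension of the empty set. *)
Definition has_dim (S : set 'cV[R]_k) (e : nat) : Prop :=
  S !=set0 /\ exists2 U, has_direction S U & \dim U = e.

Definition face (P F : set 'cV[R]_k) : Prop :=
  exists c : 'rV[R]_k,
    F = [set x | P x /\ forall x', P x' -> (c *m x') 0 0 <= (c *m x) 0 0].

Definition facet (P F : set 'cV[R]_k) : Prop :=
  face P F /\ exists2 e, has_dim P e.+1 & has_dim F e.

(* Linear forms on 'cV_k are represented by row vectors;
   this is (Q - y)^o. *)
Definition polar_at (Q : set 'cV[R]_k) (y : 'cV[R]_k) : set 'rV[R]_k :=
  [set z | forall y', Q y' -> (z *m (y' - y)) 0 0 <= 1].

Definition has_nfacets (P : set 'cV[R]_k) (N : nat) : Prop :=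
  ([set F | facet P F] #= `I_N)%card.

End dimension_and_facets.

Definition cell {R : realType} {d n : nat} (A : 'M[R]_(d, n))
    (C : set 'cV[R]_d) : Prop :=
  chamber_complex A C /\ has_dim C d.

Definition kernel_basis {R : realType} {d n m : nat} (A : 'M[R]_(d, n))
    (B : 'M[R]_(n, m)) : Prop :=
  row_free B^T /\ forall x : 'cV[R]_n, A *m x = 0 <-> exists z, x = B *m z.

Definition polytopeP {R : realType} {d n : nat} (A : 'M[R]_(d, n))
    (b : 'cV[R]_d) : set 'cV[R]_n :=
  [set x | nonneg_orthant x /\ A *m x = b].

Definition polytopeQ {R : realType} {d n m : nat} (A : 'M[R]_(d, n))
    (B : 'M[R]_(n, m)) (b : 'cV[R]_d) : set 'cV[R]_m :=
  mulmx B^T @` polytopeP A b.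

(* m-dimensional Lebesgue measure, as the m-fold product of the Lebesgue
   measure on R: the product measure of a set is the integral of the measures
   of its slices. On R^0 it is the unit mass at the origin. *)
Fixpoint vol {R : realType} (m : nat) : set 'rV[R]_m -> \bar R :=
  match m with
  | 0 => fun S => (\1_S (0 : 'rV[R]_0))%:E
  | m'.+1 => fun S =>
      (\int[@lebesgue_measure R]_t
        vol [set v : 'rV[R]_m' | S (row_mx (t%:M : 'rV[R]_1) v)])%E
  end.

Definition mpoly_coprime {R : realType} {k : nat} (p q : mpoly k R) : Prop :=
  forall g p' q' : mpoly k R, p = g * p' -> q = g * q' -> g \is a GRing.unit.

(* On D, the function f is the quotient of two homogeneous polynomials p and q,
   in lowest terms and of respective degrees dp and dq, whose denominator
   vanishes nowhere on D. It is then homogeneous of degree dp - dq. *)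
Definition homog_rational_on {R : realType} {k : nat} (D : set 'cV[R]_k)
    (f : 'cV[R]_k -> \bar R) (dp dq : nat) : Prop :=
  exists p q : mpoly k R,
    [/\ p != 0 /\ p \is ishomog1 dp mdeg,
        q != 0 /\ q \is ishomog1 dq mdeg,
        mpoly_coprime p q &
        forall w : 'cV[R]_k, D w ->
          meval (w ^~ 0) q != 0 /\
          f w = (meval (w ^~ 0) p / meval (w ^~ 0) q)%:E].

Lemma vol0 {R : realType} (m : nat) : vol (set0 : set 'rV[R]_m) = 0%E.
Proof.
elim: m => [|m IH] /=; first by rewrite indic0.
by apply: integral0_eq => t _; exact: IH.
Qed.

Lemma vol_box {R : realType} (m : nat) (a b : 'rV[R]_m) :
  (forall i, a 0 i <= b 0 i) ->
  vol [set x : 'rV[R]_m | forall i, a 0 i <= x 0 i <= b 0 i] =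
  (\prod_(i < m) (b 0 i - a 0 i))%:E.
Proof.
elim: m a b => [|m IH] a b ab /=.
  by rewrite big_ord0 indicE mem_set//= => -[].
pose a' : 'rV[R]_m := \row_j a 0 (lift ord0 j).
pose b' : 'rV[R]_m := \row_j b 0 (lift ord0 j).
have mem_ab (t : R) : (t \in `[a 0 ord0, b 0 ord0]) =
    (a 0 ord0 <= t <= b 0 ord0) by rewrite in_itv.
have slice (t : R) :
    vol [set v : 'rV[R]_m | forall i : 'I_m.+1,
           a 0 i <= (row_mx (t%:M : 'rV[R]_1) v) 0 i <= b 0 i] =
    ((\prod_(i < m) (b' 0 i - a' 0 i))%:E *
     (\1_`[a 0 ord0, b 0 ord0] t)%:E)%E.
  have E0 (v : 'rV[R]_m) : row_mx (t%:M : 'rV[R]_1) v 0 (ord0 : 'I_m.+1) = t.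
    have -> : (ord0 : 'I_m.+1) = lshift m (ord0 : 'I_1) by apply/val_inj.
    by rewrite row_mxEl mxE eqxx mulr1n.
  have ES (v : 'rV[R]_m) (j : 'I_m) :
      row_mx (t%:M : 'rV[R]_1) v 0 (lift ord0 j : 'I_m.+1) = v 0 j.
    have -> : (lift ord0 j : 'I_m.+1) = rshift 1 j by apply/val_inj.
    by rewrite row_mxEr.
  rewrite indicE; case: (boolP (t \in `[a 0 ord0, b 0 ord0])) => tab.
    rewrite mem_set//= mule1 -IH => [|i]; last by rewrite !mxE.
    congr vol; apply/seteqP; split=> v /= H i.
      by move: (H (lift ord0 i)); rewrite ES !mxE.
    case: (unliftP ord0 i) => [j ->|->]; last by rewrite E0 -mem_ab.
    by move: (H j); rewrite ES !mxE.
  rewrite memNset/= ?mule0; last exact/negP.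
  have -> : [set v : 'rV[R]_m | forall i : 'I_m.+1,
           a 0 i <= (row_mx (t%:M : 'rV[R]_1) v) 0 i <= b 0 i] = set0.
    apply/seteqP; split=> // v /= /(_ ord0); rewrite E0 -mem_ab => tab'.
    by rewrite tab' in tab.
  exact: vol0.
under eq_integral do rewrite slice.
rewrite integralZl//; last first.
  exact: integrable_indic_itv.
have -> : (\int[@lebesgue_measure R]_t (\1_`[a 0 ord0, b 0 ord0] t)%:E)%E =
    @lebesgue_measure R `[a 0 ord0, b 0 ord0] by rewrite integral_indic// setIT.
rewrite lebesgue_measure_itv/= lte_fin.
rewrite big_ord_recl mulrC EFinM; congr (_ * _)%E.
  by congr (_%:E); apply: eq_bigr => i _; rewrite !mxE.
case: ifPn => [//|]; rewrite -leNgt => ba.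
by have /eqP -> : a 0 ord0 == b 0 ord0; rewrite ?subrr// eq_le ab ba.
Qed.

(* Main.v *)
(* Let M = [A; B^T], an invertible matrix, and x = M^-1 (b, y), whose entries
   are linearly independent linear forms in (b, y). For b in C and y interior to Q_b
   all x_i are positive and y = B^T x. Fix b1 with C = chamber b1; let T be the
   set of supports of the vertices of P_b1. Each s in T is a basis of columns of
   A with C contained in cone(A_s), and by linear programming at b1 the normal
   cones at the vertices s in T cover R^(n-d); their interiors are disjoint
   because at b0 in int C the vertices are nondegenerate. For every b in C, also
   on the boundary, the polar of Q_b - y is therefore the essentially disjoint
   union over s in T of simplices of volume a_s / prod_(i notin s) x_i, a_s > 0.
   The facets of P_b0 are the sets {x_i = 0} with i in F = union of the
   complements of the s in T, so the common denominator prod_(i in F) x_i has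
   degree n_C. It is coprime to the numerator: a linear form x_i with i in F
   does not divide it, since at the point with x_i = 0 and all other x_j = 1 every
   term is nonnegative and the one of an s not containing i is positive. *)
From HB Require Import structures.
Require Import Defs.
From mathcomp Require Import all_boot all_order all_algebra.
From mathcomp Require Import all_classical all_reals all_analysis.
From mathcomp Require Import -(notations) mpoly.
From mathcomp Require Import measurable_realfun zify ring lra.
Set Implicit Arguments.
Unset Strict Implicit.
Unset Printing Implicit Defensive.
Import Order.TTheory GRing.Theory Num.Theory.
Import numFieldNormedType.Exports.
Local Open Scope classical_set_scope.
Local Open Scope ring_scope.

(** * Lebesgue volume under linear maps *)

Section measurable_rV.
Context {R : realType} (m : nat).

(** [vol] assigns a value to every set by iterated integration; it is shown to be a measure on the
    product sigma-algebra, generated by the coordinate maps. *)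
Definition rV_cylinders : set (set 'rV[R]_m) :=
  [set X | exists i, exists2 Y : set (measurableTypeR R),
    measurable Y & X = (fun v : 'rV[R]_m => v 0 i) @^-1` Y].

HB.instance Definition _ := @isMeasurable.Build (sigma_display rV_cylinders)
  'rV[R]_m <<s rV_cylinders >> (@sigma_algebra0 _ setT rV_cylinders)
  (@sigma_algebraC _ rV_cylinders) (@sigma_algebra_bigcup _ setT rV_cylinders).

Lemma measurable_coord (i : 'I_m) :
  measurable_fun setT (fun v : 'rV[R]_m => v 0 i : measurableTypeR R).
Proof.
move=> _ Y mY; rewrite setTI; apply: sub_sigma_algebra.
by exists i, Y.
Qed.

Lemma measurable_fun_rV d (T : measurableType d) (f : T -> 'rV[R]_m) :
  (forall i, measurable_fun setT (fun x => f x 0 i : measurableTypeR R)) ->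
  measurable_fun setT f.
Proof.
move=> mf; apply: (measurability rV_cylinders); first by [].
by move=> _ [_ [i [Y mY ->]] <-]; exact: mf.
Qed.

End measurable_rV.

Section cons_rV.
Context {R : realType} (m : nat).

(** The identification of $\mathbb{R}\times\mathbb{R}^m$ with $\mathbb{R}^{m+1}$ along which [vol]
    recurses. *)
Definition consrV (x : measurableTypeR R * 'rV[R]_m) : 'rV[R]_m.+1 :=
  row_mx (x.1%:M : 'rV[R]_1) x.2.

Lemma consrV0 x : consrV x 0 0 = x.1.
Proof.
have -> : (0 : 'I_m.+1) = lshift m (0 : 'I_1) by apply/val_inj.
by rewrite /consrV [LHS]row_mxEl mxE eqxx mulr1n.
Qed.

Lemma consrVS x j : consrV x 0 (lift 0 j) = x.2 0 j.
Proof.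
have -> : (lift 0 j : 'I_m.+1) = rshift 1 j by apply/val_inj.
by rewrite /consrV [LHS]row_mxEr.
Qed.

Lemma measurable_consrV : measurable_fun setT consrV.
Proof.
apply: measurable_fun_rV => i.
case: (unliftP 0 i) => [j ->|->].
  rewrite (_ : (fun x => _) =
      (fun v : 'rV[R]_m => v 0 j : measurableTypeR R) \o snd).
    by apply: measurableT_comp => //; exact: measurable_coord.
  by apply/funext => x; rewrite consrVS.
rewrite (_ : (fun x => _) = fst)//.
by apply/funext => x; rewrite consrV0.
Qed.

Lemma consrVD x y : consrV x + consrV y = consrV (x.1 + y.1, x.2 + y.2).
Proof.
apply/rowP => i; rewrite mxE; case: (unliftP 0 i) => [j ->|->].
  by rewrite !consrVS mxE.
by rewrite !consrV0.
Qed.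

Lemma consrV_mul_block x a w u U :
  consrV x *m (block_mx a%:M w u U : 'M[R]_(1 + m)) =
  consrV (a * x.1 + (x.2 *m u) 0 0, x.1 *: w + x.2 *m U).
Proof.
apply: etrans (@mul_row_block R 1 1 m 1 m x.1%:M x.2 a%:M w u U) _.
rewrite [_ *m w]mul_scalar_mx /consrV/=; congr row_mx.
by apply/matrixP => i j; rewrite !ord1 -scalar_mxM !mxE eqxx !mulr1n mulrC.
Qed.

Definition unconsrV (v : 'rV[R]_m.+1) : measurableTypeR R * 'rV[R]_m :=
  (v 0 0, \row_j v 0 (lift 0 j)).

Lemma consrVK : cancel consrV unconsrV.
Proof.
move=> [t v]; rewrite /unconsrV consrV0; congr pair.
by apply/rowP => j; rewrite mxE consrVS.
Qed.

Lemma unconsrVK : cancel unconsrV consrV.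
Proof.
move=> v; apply/rowP => i; case: (unliftP 0 i) => [j ->|->].
  by rewrite consrVS mxE.
by rewrite consrV0.
Qed.

Lemma measurable_unconsrV : measurable_fun setT unconsrV.
Proof.
apply: measurable_fun_pair; first exact: measurable_coord.
apply: measurable_fun_rV => i.
rewrite (_ : (fun x => _) =
    fun v : 'rV[R]_m.+1 => v 0 (lift 0 i) : measurableTypeR R).
  exact: measurable_coord.
by apply/funext => v; rewrite mxE.
Qed.
End cons_rV.

Section volume.
Context {R : realType}.
Local Open Scope ereal_scope.

Lemma vol_ge0 m (S : set 'rV[R]_m) : 0 <= vol S.
Proof.
elim: m S => [|m IH] S /=; first by rewrite lee_fin.
by apply: integral_ge0.
Qed.

Lemma vol_consrV m (S : set 'rV[R]_m.+1) :
  vol S = \int[@lebesgue_measure R]_t vol (xsection (consrV (m := m) @^-1` S) t).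
Proof.
apply: eq_integral => t _ /=; congr vol.
by apply/seteqP; split=> v /=; rewrite /xsection/= in_setE.
Qed.

(** On $\mathbb{R}^{m+1}$, [vol] is the image under [consrV] of the product of Lebesgue measure and
    [mu]. The bundled measure [mu] stands for [vol] on $\mathbb{R}^m$ inside the induction that
    makes [vol] a measure. *)
Lemma vol_sigma_finite_additiveS m
    (mu : {sigma_finite_measure set 'rV[R]_m -> \bar R}) :
  (forall S, vol S = mu S) ->
  semi_sigma_additive (@vol R m.+1) /\ sigma_finite setT (@vol R m.+1).
Proof.
move=> muE.
pose pr : {measure set (measurableTypeR R * 'rV[R]_m)%type -> \bar R} :=
  (@lebesgue_measure R \x mu).
have -> : @vol R m.+1 = pushforward pr (@consrV R m).
  apply/funext => S; rewrite vol_consrV.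
  by apply: eq_integral => t _ /=; exact: muE.
split.
  have mc := measurable_consrV (R := R) (m := m).
  pose mf : {mfun _ >-> _} :=
    HB.pack (@consrV R m) (isMeasurableFun.Build _ _ _ _ _ mc).
  exact: (@measure_semi_sigma_additive _ _ _ (pushforward pr mf)).
(* Products of the two exhausting sequences exhaust the space: both are nondecreasing, so the larger
   of two indices serves both factors. *)
have /sigma_finiteP[F [FT ndF Foo]] := sigma_finiteT (@lebesgue_measure R).
have /sigma_finiteP[G [GT ndG Goo]] := sigma_finiteT mu.
exists (fun i => @unconsrV R m @^-1` (F i `*` G i)) => [|i].
  apply/seteqP; split=> // v _.
  have [i _ Fi] : (\bigcup_i F i) (v 0%R 0%R) by rewrite -FT.
  have [j _ Gj] : (\bigcup_i G i) (unconsrV v).2 by rewrite -GT.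
  exists (maxn i j) => //; split=> /=.
    by move: Fi; apply/subsetPset/ndF/leq_maxl.
  by move: Gj; apply/subsetPset/ndG/leq_maxr.
have [[mF Foo_] [mG Goo_]] := (Foo i, Goo i); split.
  rewrite -[X in measurable X]setTI; apply: measurable_unconsrV => //.
  exact: measurableX.
rewrite /pushforward -comp_preimage (_ : _ \o _ = id); last first.
  by apply/funext => x; exact: consrVK.
by rewrite preimage_id /pr/= product_measure1E// lte_mul_pinfty// ge0_fin_numE.
Qed.

Lemma vol_sigma_finite_additive m :
  semi_sigma_additive (@vol R m) /\ sigma_finite setT (@vol R m).
Proof.
elim: m => [|m [sa sf]].
  have -> : @vol R 0 = \d_((0 : 'rV[R]_0)%R) by apply/funext.
  split; first exact: measure_semi_sigma_additive.
  exact: sigma_finiteT.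
pose mu0 : {measure set 'rV[R]_m -> \bar R} := HB.pack (@vol R m)
  (measure_function.isMeasure.Build _ _ _ (@vol R m) (vol0 m) (@vol_ge0 m) sa).
pose mu : {sigma_finite_measure set 'rV[R]_m -> \bar R} := HB.pack (@vol R m) mu0
  (Measure_isSigmaFinite.Build _ _ _ mu0 sf).
exact: (@vol_sigma_finite_additiveS m mu).
Qed.

HB.instance Definition _ m := measure_function.isMeasure.Build _ _ _ (@vol R m)
  (vol0 m) (@vol_ge0 m) (vol_sigma_finite_additive m).1.

HB.instance Definition _ m := Measure_isSigmaFinite.Build _ _ _ (@vol R m)
  (vol_sigma_finite_additive m).2.

End volume.

Section linear_change.
Context {R : realType}.

Lemma measurable_preimage d d' (T : measurableType d) (T' : measurableType d')
    (f : T -> T') S :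
  measurable_fun setT f -> measurable S -> measurable (f @^-1` S).
Proof. by move=> mf mS; rewrite -[X in measurable X]setTI; exact: mf. Qed.

Definition affine (a b : R) : measurableTypeR R -> measurableTypeR R :=
  fun t => a * t + b.

Lemma measurable_affine (a b : R) : measurable_fun setT (affine a b).
Proof. by apply: measurable_funD => //; exact: measurable_funM. Qed.

(** The image measure scaled by $|a|$ gives each interval $]x,y]$ its length, and this characterizes
    Lebesgue measure. *)
Lemma lebesgue_measure_affine (a b : R) (S : set (measurableTypeR R)) : a != 0 ->
  measurable S ->
  (lebesgue_measure (affine a b @^-1` S) =
  (`|a|^-1)%:E * lebesgue_measure S)%E.
Proof.
move=> a0 mS.
have na : 0 < `|a| by rewrite normr_gt0.
pose push : {measure set (measurableTypeR R) -> \bar R} :=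
  pushforward (@lebesgue_measure R) (affine a b).
pose nu : {measure set (measurableTypeR R) -> \bar R} := 
  mscale (NngNum (ltW na)) (push (measurable_affine a b)).
suff -> : lebesgue_measure S = nu S.
  rewrite /nu/= /mscale/= muleA -EFinM mulVf ?mul1e//; exact: lt0r_neq0.
apply: (@lebesgue_measure_unique _ nu) => // _ [[x y]] _ <-.
rewrite /nu/= /mscale/= /push/= /pushforward/= lebesgue_measure_itv/=.
have [a_gt0|a_lt0|/eqP] := ltgtP 0 a; last by rewrite eq_sym (negPf a0).
  rewrite (_ : _ @^-1` _ = `](x - b) / a, (y - b) / a]%classic); last first.
    by apply/seteqP; split=> t /=; rewrite !in_itv/= ltr_pdivrMr//
      ler_pdivlMr// ltrBlDr lerBrDr mulrC.
  rewrite lebesgue_measure_itv/= !lte_fin ltr_pM2r ?invr_gt0// ltrD2r gtr0_norm//.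
  case: ifP => _; last by rewrite mule0.
  rewrite -!EFinB -EFinM; congr EFin; field; exact: lt0r_neq0.
(* For negative $a$ the preimage is closed on the left instead of on the right, with no effect on
   its length. *)
rewrite (_ : _ @^-1` _ = `[(y - b) / a, (x - b) / a[%classic); last first.
  by apply/seteqP; split=> t /=; rewrite !in_itv/= ler_ndivrMr//
    ltr_ndivlMr// ltrBlDr lerBrDr mulrC andbC.
rewrite lebesgue_measure_itv/= !lte_fin ltr_nM2r ?invr_lt0// ltrD2r ltr0_norm//.
case: ifP => _; last by rewrite mule0.
rewrite -!EFinB -EFinM; congr EFin; field; exact: ltr0_neq0.
Qed.

Lemma measurable_mulmx m k (L : 'M[R]_(m, k)) :
  measurable_fun setT (fun v : 'rV[R]_m => v *m L).
Proof.
apply: measurable_fun_rV => i.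
rewrite (_ : (fun x => _) =
    fun x : 'rV[R]_m => \sum_(j < m) (x 0 j * L j i) : measurableTypeR R).
  apply: measurable_sum => j.
  apply: measurable_funM => //; exact: measurable_coord.
by apply/funext => x; rewrite mxE.
Qed.

Lemma measurable_addr m (w : 'rV[R]_m) :
  measurable_fun setT (fun v : 'rV[R]_m => v + w).
Proof.
apply: measurable_fun_rV => i.
rewrite (_ : (fun x => _) =
    fun x : 'rV[R]_m => x 0 i + w 0 i : measurableTypeR R).
  apply: measurable_funD => //; exact: measurable_coord.
by apply/funext => x; rewrite mxE.
Qed.

Lemma measurable_consrV_preimage m (S : set 'rV[R]_m.+1) :
  measurable S -> measurable (@consrV R m @^-1` S).
Proof. by apply: measurable_preimage; exact: measurable_consrV. Qed.

(** Tonelli: the slices are taken in the first coordinate, the remaining ones being fixed, instead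
    of the other way round. *)
Lemma vol_consrV_ysection m (S : set 'rV[R]_m.+1) : measurable S ->
  (vol S = \int[@vol R m]_v lebesgue_measure (ysection (@consrV R m @^-1` S) v))%E.
Proof.
move=> mS; rewrite vol_consrV.
apply: (product_measure_unique (m1 := @lebesgue_measure R) (m2 := @vol R m)
  (m' := (@lebesgue_measure R \x^ @vol R m)%E)).
  by move=> A B mA mB; exact: product_measure2E.
exact: measurable_consrV_preimage.
Qed.

Lemma vol_translate m (w : 'rV[R]_m) S : measurable S ->
  vol ((fun v => v + w) @^-1` S) = vol S.
Proof.
elim: m w S => [|m IH] w S mS.
  by congr vol; apply/seteqP; split=> v /=; rewrite (thinmx0 w) addr0.
(* The translation splits into one of the last coordinates, handled slicewise by induction, and one
   of the first coordinate, handled by the affine case in dimension one. *)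
have -> : (fun v => v + w) = (fun v => v + consrV (w 0 0, 0)) \o
    (fun v => v + consrV (0, (unconsrV w).2)).
  apply/funext => v /=; rewrite -addrA; congr (_ + _).
  by rewrite -[LHS]unconsrVK consrVD/= add0r addr0.
rewrite comp_preimage.
have mS' := measurable_preimage (measurable_addr (consrV (w 0 0, 0))) mS.
set S' := (_ @^-1` S) in mS' *.
transitivity (vol S').
  rewrite !vol_consrV; apply: eq_integral => t _.
  rewrite -[RHS](IH (unconsrV w).2); last first.
    by apply: measurable_xsection; exact: measurable_consrV_preimage.
  congr vol; apply/funext => v /=; rewrite /preimage/= /xsection/= !in_setE.
  by congr S'; apply: etrans (consrVD _ _) _; rewrite /= addr0.
rewrite !vol_consrV_ysection//; apply: eq_integral => v _.
rewrite -[RHS]mul1e -{1}(invr1 R) -{1}(normr1 R).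
rewrite -(lebesgue_measure_affine (w 0 0))//; last first.
  by apply: measurable_ysection; exact: measurable_consrV_preimage.
congr lebesgue_measure; apply/funext => t /=.
rewrite /preimage/= /ysection/= !in_setE.
by congr S; apply: etrans (consrVD _ _) _; rewrite /= addr0 /affine mul1r.
Qed.

(** Stated for preimages, whence the inverse of the determinant; no image of a set has to be shown
    measurable. *)
Definition vol_scaled m (L : 'M[R]_m) := forall S, measurable S ->
  (vol ((fun v => v *m L) @^-1` S) = (`|\det L|^-1)%:E * vol S)%E.

Lemma vol_scaled_mul m (L1 L2 : 'M[R]_m) :
  vol_scaled L1 -> vol_scaled L2 -> vol_scaled (L1 *m L2).
Proof.
move=> h1 h2 S mS.
have -> : (fun v : 'rV[R]_m => v *m (L1 *m L2)) =
    (fun v => v *m L2) \o (fun v => v *m L1).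
  by apply/funext => v; rewrite /= mulmxA.
rewrite comp_preimage h1 ?h2//.
  by rewrite muleA -EFinM det_mulmx normrM invfM.
by apply: measurable_preimage => //; exact: measurable_mulmx.
Qed.

Lemma vol_scaled_block_upper m (w : 'rV[R]_m) (U : 'M[R]_m) :
  vol_scaled U -> vol_scaled (block_mx 1%:M w 0 U : 'M[R]_(1 + m)).
Proof.
move=> hU S mS; rewrite det_ublock det1 mul1r !vol_consrV.
have mt t : measurable (xsection (consrV (m := m) @^-1` S) t).
  by apply: measurable_xsection; exact: measurable_consrV_preimage.
rewrite -ge0_integralZl//; last first.
- by apply: measurable_fun_xsection; exact: measurable_consrV_preimage.
apply: eq_integral => t _.
rewrite -[in RHS](vol_translate (t *: w))// -hU; last first.
  by apply: measurable_preimage => //; exact: measurable_addr.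
congr vol; apply/funext => v /=; rewrite /preimage/= /xsection/= !in_setE.
congr S; apply: etrans (consrV_mul_block _ _ _ _ _) _.
by rewrite mulmx0 mxE addr0 mul1r addrC.
Qed.

Lemma vol_scaled_block_lower m (a : R) (u : 'cV[R]_m) : a != 0 ->
  vol_scaled (block_mx a%:M 0 u 1%:M : 'M[R]_(1 + m)).
Proof.
move=> a0 S mS; rewrite det_lblock det1 mulr1 det_scalar1.
have mS' := measurable_consrV_preimage mS.
rewrite !vol_consrV_ysection//; last first.
  by apply: measurable_preimage => //; exact: measurable_mulmx.
rewrite -ge0_integralZl//; last exact: measurable_fun_ysection.
apply: eq_integral => v _.
rewrite -(lebesgue_measure_affine ((v *m u) 0 0))//; last first.
  exact: measurable_ysection.
congr lebesgue_measure; apply/funext => t /=.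
rewrite /preimage/= /ysection/= !in_setE.
congr S; apply: etrans (consrV_mul_block _ _ _ _ _) _.
by rewrite /= scaler0 add0r mulmx1.
Qed.

(* If the corner entry a of L is nonzero, then L is the product of [a 0; u 1],
   which for fixed last coordinates is an affine map of the first one, and
   [1 w; 0 U], which acts on every slice by U and a translation. A shear of the
   form [1 w; 0 1] makes the corner entry nonzero. *)
Lemma vol_mulmx m (L : 'M[R]_m) : L \in unitmx -> vol_scaled L.
Proof.
elim: m L => [|m IH] L uL.
  move=> S mS; rewrite det_mx00 normr1 invr1 mul1e.
  by congr vol; apply/seteqP; split=> v /=; rewrite !thinmx0.
have h (M : 'M[R]_(1 + m)) : M \in unitmx -> M 0 0 != 0 -> vol_scaled M.
  move=> uM M00; set a := M 0 0 in M00.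
  have Ma : ulsubmx M = a%:M.
    rewrite [LHS]mx11_scalar !mxE /a; congr (_%:M).
    by congr (M _ _); apply/val_inj.
  pose U := drsubmx M - a^-1 *: (dlsubmx M *m ursubmx M).
  have ME : M = block_mx a%:M 0 (dlsubmx M) 1%:M *m
      block_mx 1%:M (a^-1 *: ursubmx M) 0 U.
    rewrite /U mulmx_block !mulmx0 !mul0mx !mulmx1 !mul1mx !addr0 -!scalemxAr.
    rewrite mul_scalar_mx scalerA mulVf// scale1r addrC subrK -Ma.
    by rewrite submxK.
  rewrite ME; apply: vol_scaled_mul; first exact: vol_scaled_block_lower.
  apply/vol_scaled_block_upper/IH.
  by move: uM; rewrite ME unitmx_mul !unitmxE det_ublock det1 mul1r => /andP[].
have [L00|L00] := eqVneq (L 0 0) 0; last exact: h.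
(* A zero first column would make the determinant vanish. *)
have [j Lj] : exists j : 'I_m, L (lift 0 j) 0 != 0.
  apply/existsP; apply: contraT; rewrite negb_exists => /forallP L0.
  move: uL; rewrite unitmxE (expand_det_col L 0) big1 ?unitr0// => i _.
  case: (unliftP 0 i) => [k ->|->]; last by rewrite L00 mul0r.
  by move: (L0 k); rewrite negbK => /eqP ->; rewrite mul0r.
(* [E 1] adds row [lift 0 j] to the first row, which puts a nonzero entry in the corner; [E (-1)] is
   its inverse. *)
pose E (b : R) : 'M[R]_(1 + m) := block_mx 1%:M (b *: delta_mx 0 j) 0 1%:M.
have vol1 k : vol_scaled (1%:M : 'M[R]_k).
  move=> S mS; rewrite det1 normr1 invr1 mul1e; congr vol.
  by apply/seteqP; split=> v /=; rewrite mulmx1.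
have E1 : E (-1) *m E 1 = 1%:M.
  rewrite /E mulmx_block !mulmx0 !mul0mx !mulmx1 !mul1mx !addr0 scale1r.
  by rewrite scaleN1r subrr !add0r -scalar_mx_block.
rewrite -[L]mul1mx -[1%:M]E1 -mulmxA.
apply: vol_scaled_mul; first exact: vol_scaled_block_upper.
apply: h.
  rewrite unitmx_mul uL andbT unitmxE det_ublock !det1 mul1r; exact: unitr1.
have E0 i : E 1 0 i = consrV (1, delta_mx 0 j) 0 i.
  rewrite /E scale1r /block_mx (_ : 0 = lshift m (0 : 'I_1)); last exact/val_inj.
  by rewrite col_mxEu.
rewrite mxE big_ord_recl (bigD1 j)//= big1 => [|i ij]; last first.
  by rewrite E0 consrVS mxE (negPf ij) mul0r.
by rewrite !E0 consrV0 consrVS mxE !eqxx L00 mulr0 add0r addr0 mul1r.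
Qed.

End linear_change.

(** * Volumes of simplices and of unions of simplices *)

Section simplices.
Context {R : realType} (m : nat).

Definition std_simplex : set 'rV[R]_m :=
  [set v | (forall i, 0 <= v 0 i) /\ \sum_i v 0 i <= 1].

Definition open_orthant : set 'rV[R]_m := [set v | forall i, 0 < v 0 i].

Lemma measurable_all_coord (Y : set (measurableTypeR R)) : measurable Y ->
  measurable [set v : 'rV[R]_m | forall i, Y (v 0 i)].
Proof.
move=> mY; rewrite [X in measurable X](_ : _ =
    \bigcap_(i in setT) ((fun v : 'rV[R]_m => v 0 i) @^-1` Y)).
  apply: fin_bigcap_measurable => // i _.
  by apply: measurable_preimage => //; exact: measurable_coord.
by apply/seteqP; split=> v /= h i; [move=> _|]; exact: h.
Qed.

Lemma measurable_std_simplex : measurable std_simplex.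
Proof.
apply: measurableI.
  rewrite [X in measurable X](_ : _ =
      [set v : 'rV[R]_m | forall i, `[0, +oo[%classic (v 0 i)]).
    exact: measurable_all_coord.
  by apply/seteqP; split=> v /= h i; have := h i; rewrite in_itv/= andbT.
rewrite [X in measurable X](_ : _ =
    (fun v : 'rV[R]_m => \sum_i v 0 i : measurableTypeR R) @^-1` `]-oo, 1]).
  apply: measurable_preimage => //; apply: measurable_sum => i.
  exact: measurable_coord.
by apply/seteqP; split=> v /=; rewrite in_itv/=.
Qed.

Lemma measurable_open_orthant : measurable open_orthant.
Proof.
rewrite (_ : open_orthant =
    [set v : 'rV[R]_m | forall i, `]0, +oo[%classic (v 0 i)]).
  exact: measurable_all_coord.
by apply/seteqP; split=> v /= h i; have := h i; rewrite in_itv/= andbT.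
Qed.

Lemma std_simplex_coord_le1 v i : std_simplex v -> v 0 i <= 1.
Proof.
move=> [v0]; apply: le_trans; rewrite (bigD1 i)//= lerDl.
by apply: sumr_ge0.
Qed.

Lemma measurable_box (a b : 'rV[R]_m) :
  measurable [set x : 'rV[R]_m | forall i, a 0 i <= x 0 i <= b 0 i].
Proof.
rewrite [X in measurable X](_ : _ = \bigcap_(i in setT)
    ((fun v : 'rV[R]_m => v 0 i) @^-1` `[a 0 i, b 0 i])).
  apply: fin_bigcap_measurable => // i _.
  by apply: measurable_preimage => //; exact: measurable_coord.
apply/seteqP; split=> v /= h i; first by move=> _; rewrite /= in_itv/=; exact: h.
by have := h i I; rewrite /= in_itv.
Qed.

(** The simplex contains the cube $[0,1/(m+1)]^m$. Positivity and finiteness of its volume suffice;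
    the value $1/m!$ never enters. *)
Lemma vol_std_simplex_gt0 : (0 < vol std_simplex)%E.
Proof.
pose a : 'rV[R]_m := 0; pose b : 'rV[R]_m := const_mx m.+1%:R^-1.
apply: (@lt_le_trans _ _
    (vol [set x : 'rV[R]_m | forall i, a 0 i <= x 0 i <= b 0 i])).
  rewrite vol_box => [|i]; last by rewrite !mxE invr_ge0.
  by rewrite lte_fin prodr_gt0// => i _; rewrite !mxE subr0 invr_gt0.
apply: le_measure; rewrite ?inE;
  [exact: measurable_box|exact: measurable_std_simplex|].
move=> v /= h; split=> [i|]; first by have /andP[] := h i; rewrite mxE.
apply: (@le_trans _ _ (\sum_(i < m) m.+1%:R^-1)).
  by apply: ler_sum => i _; have /andP[] := h i; rewrite !mxE.
rewrite sumr_const card_ord -[_ *+ _]mulr_natl ler_pdivrMr// mul1r ler_nat//.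
Qed.

Lemma vol_std_simplex_fin : (vol std_simplex < +oo)%E.
Proof.
pose a : 'rV[R]_m := 0; pose b : 'rV[R]_m := const_mx 1.
apply: (@le_lt_trans _ _
    (vol [set x : 'rV[R]_m | forall i, a 0 i <= x 0 i <= b 0 i])).
  apply: le_measure; rewrite ?inE;
    [exact: measurable_std_simplex|exact: measurable_box|].
  move=> v vS i; rewrite !mxE std_simplex_coord_le1// andbT.
  exact: vS.1.
by rewrite vol_box ?ltry// => i; rewrite !mxE.
Qed.

Lemma vol_std_simplex_open : vol (std_simplex `&` open_orthant) = vol std_simplex.
Proof.
have mS := measurable_std_simplex; have mO := measurable_open_orthant.
apply/eqP; rewrite eq_le; apply/andP; split.
  by apply: le_measure; rewrite ?inE//; exact: measurableI.
rewrite (measureDI _ mS mO).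
rewrite -[leRHS]add0e leeD2r//.
(* The part of the simplex outside the open orthant is covered by the boxes [box j], each with side
   $0$ in direction $j$ and side $1$ in the others. *)
pose a : 'rV[R]_m := 0; pose b j : 'rV[R]_m := \row_i (i != j)%:R.
pose box j := [set x : 'rV[R]_m | forall i, a 0 i <= x 0 i <= b j 0 i].
have box0 j : vol (box j) = 0%E.
  rewrite vol_box => [|i]; last by rewrite !mxE ler0n.
  by rewrite (bigD1 j)//= !mxE eqxx subrr mul0r.
apply: (@le_trans _ _ (\sum_(j \in [set: 'I_m]) vol (box j))%E).
  apply: content_sub_fsum => //.
  - exact: finite_finset.
  - by move=> j _; exact: measurable_box.
  - exact: measurableD.
  move=> v [vS] /= nv.
  have [j vj] : exists j, v 0 j = 0.
    apply: contrapT => h; apply: nv => j; rewrite lt_neqAle vS.1 andbT eq_sym.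
    by apply/eqP => vj; apply: h; exists j.
  exists j => // i; rewrite !mxE vS.1/=.
  have [->|_] := eqVneq i j; first by rewrite vj.
  exact: std_simplex_coord_le1.
by rewrite fsbig1.
Qed.

(* The overlaps need not be shown to be null: removing the coordinate
   hyperplanes makes the simplices disjoint without changing their volumes, so
   the sum of these volumes bounds vol K from both sides. *)
Lemma vol_simplicial_cover (I : choiceType) (r : seq I) (L : I -> 'M[R]_m)
    (x : I -> 'rV[R]_m) (K : set 'rV[R]_m) :
  uniq r ->
  (forall i, i \in r -> L i \in unitmx) ->
  (forall i, i \in r -> forall k, 0 < x i 0 k) ->
  K = \bigcup_(i in [set` r])
    [set z | (forall k, 0 <= (z *m L i) 0 k) /\
             \sum_k (z *m L i) 0 k * x i 0 k <= 1] ->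
  (forall i j z, i \in r -> j \in r ->
    open_orthant (z *m L i) -> open_orthant (z *m L j) -> i = j) ->
  vol K = (\sum_(i <- r)
    fine (vol std_simplex) / (`|\det (L i)| * \prod_k x i 0 k))%:E.
Proof.
move=> ur uL x0 KE disj.
(* Scaling the coordinates by [x i] turns each piece of the cover into the preimage of the standard
   simplex under a linear map. *)
pose M i := L i *m diag_mx (x i).
have ME i z k : (z *m M i) 0 k = (z *m L i) 0 k * x i 0 k.
  by rewrite mulmxA mul_mx_diag mxE.
have uM i : i \in r -> M i \in unitmx.
  move=> ir; rewrite unitmx_mul uL// unitmxE det_diag unitfE.
  by apply: lt0r_neq0; apply: prodr_gt0 => k _; exact: x0.
pose D i := (fun v => v *m M i) @^-1` std_simplex.
pose E i := (fun v => v *m M i) @^-1` (std_simplex `&` open_orthant).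
have mD i : measurable (D i).
  apply: measurable_preimage; first exact: measurable_mulmx.
  exact: measurable_std_simplex.
have mE i : measurable (E i).
  apply: measurable_preimage; first exact: measurable_mulmx.
  apply: measurableI; first exact: measurable_std_simplex.
  exact: measurable_open_orthant.
have KD : K = \bigcup_(i in [set` r]) D i.
  rewrite KE; apply: eq_bigcupr => i ir; apply/seteqP; split=> z [/= z0 z1]; split.
  - by move=> k; rewrite ME mulr_ge0//; apply/ltW/x0.
  - by under eq_bigr do rewrite ME.
  - by move=> k; have := z0 k; rewrite ME pmulr_lge0//; apply: x0.
  - by move: z1; under eq_bigr do rewrite ME.
have mK : measurable K by rewrite KD; apply: fin_bigcup_measurable.
have volDE i : i \in r -> vol (D i) = vol (E i).
  move=> ir; rewrite /D /E !vol_mulmx ?uM//.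
  - by rewrite vol_std_simplex_open.
  - apply: measurableI; first exact: measurable_std_simplex.
    exact: measurable_open_orthant.
  - exact: measurable_std_simplex.
transitivity (\sum_(i <- r) vol (D i))%E; last first.
  rewrite -sumEFin; apply: eq_big_seq => i ir.
  rewrite /D vol_mulmx ?uM//; last exact: measurable_std_simplex.
  rewrite -[vol std_simplex]fineK ?ge0_fin_numE ?vol_std_simplex_fin//.
  rewrite -EFinM fineK; last by rewrite ge0_fin_numE ?vol_std_simplex_fin.
  rewrite mulrC det_mulmx det_diag normrM [`|\prod_k _|]ger0_norm//.
  by apply: prodr_ge0 => k _; apply/ltW/x0.
apply/eqP; rewrite eq_le; apply/andP; split.
  rewrite fsbig_seq//; apply: content_sub_fsum => //.
  by rewrite KD.
rewrite (eq_big_seq (fun i => vol (E i)))// fsbig_seq//.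
rewrite -measure_fin_bigcup//.
- apply: le_measure; rewrite ?inE//; first exact: fin_bigcup_measurable.
  by rewrite KD; apply: subset_bigcup => i _ z [].
- move=> i j ir jr [z [[_ zi] [_ zj]]]; apply: (disj _ _ z) => // k.
  + by have := zi k; rewrite ME pmulr_lgt0//; apply: x0.
  + by have := zj k; rewrite ME pmulr_lgt0//; apply: x0.
Qed.

End simplices.

(** * Basic solutions and chambers *)

Section support.
Context {R : realType} {n : nat}.
Implicit Types (x w : 'cV[R]_n) (s : {set 'I_n}).

Definition supp x : {set 'I_n} := [set i | x i 0 != 0]%SET.

Definition supported s x := forall i, i \notin s -> x i 0 = 0.

Lemma supported_supp x : supported (supp x) x.
Proof. by move=> i; rewrite inE negbK => /eqP. Qed.

Lemma supp_sub s x : supported s x -> supp x \subset s.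
Proof.
move=> sx; apply/fintype.subsetP => i; rewrite inE; apply: contraR => /sx ->.
by rewrite eqxx.
Qed.

Lemma small_step x w :
  exists2 e : R, 0 < e & forall i, 0 < x i 0 -> 0 < x i 0 + e * w i 0.
Proof.
(* As $1/0=0$ here, indices with $x_i=0$ contribute nothing. If $x_i>0$ then $|w_i|\le S x_i$, and
   the step $1/(1+S)$ moves $x_i$ by less than $x_i$. *)
pose S : R := \sum_i `|w i 0| / `|x i 0|.
have S0 : 0 <= S by apply: sumr_ge0 => i _; rewrite divr_ge0.
have e0 : 0 < (1 + S)^-1 by rewrite invr_gt0 ltr_wpDr.
exists (1 + S)^-1 => // i xi.
have wS : `|w i 0| <= S * x i 0.
  rewrite -ler_pdivrMr// /S (bigD1 i)//= (gtr0_norm xi) lerDl.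
  by apply: sumr_ge0 => j _; rewrite divr_ge0.
have : - (S * x i 0) <= w i 0.
  by rewrite lerNl; apply: le_trans wS; rewrite ler_normr lexx orbT.
set e := (1 + S)^-1 in e0 *.
rewrite -(ler_pM2l e0) => h.
have ex : 0 < e * x i 0 by rewrite mulr_gt0.
have xE : x i 0 = e * x i 0 + e * (S * x i 0).
  rewrite mulrA -mulrDl -[X in (X + _)]mulr1 -mulrDr mulVf ?mul1r//.
  by rewrite lt0r_neq0// ltr_wpDr.
lra.
Qed.

End support.

Section lp.
Context {R : realType} {d n : nat} (A : 'M[R]_(d, n)).
Implicit Types (x w : 'cV[R]_n) (s : {set 'I_n}) (c : 'rV[R]_n) (b : 'cV[R]_d).

Lemma colsub_mulmx k (f : 'I_k -> 'I_n) : colsub f A = A *m colsub f 1%:M.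
Proof.
apply/matrixP => i j; rewrite !mxE (bigD1 (f j))//= big1 => [|l lj].
  by rewrite !mxE eqxx mulr1 addr0.
by rewrite !mxE (negPf lj) mulr0.
Qed.

(** Coefficient vectors indexed by $s$ are extended by zero, so that all column subsets share the
    space $\mathbb{R}^n$. *)
Lemma cone_colsetP s b : cone (colset A s) b <->
  exists x, [/\ nonneg_orthant x, supported s x & A *m x = b].
Proof.
pose f := fun k : 'I_#|s| => enum_val k.
split=> [[y y0 <-]|[x [x0 sx <-]]].
  exists (colsub f 1%:M *m y); split; last by rewrite mulmxA -colsub_mulmx.
  - by move=> i; rewrite mxE; apply: sumr_ge0 => k _; rewrite !mxE mulr_ge0.
  - move=> i si; rewrite mxE big1// => k _; rewrite !mxE.
    by case: eqP => [fi|]; rewrite ?mul0r//; move: si; rewrite fi enum_valP.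
exists (rowsub f x) => [i|]; first by rewrite mxE.
rewrite /colset colsub_mulmx -mulmxA; congr (_ *m _); apply/colP => i; rewrite mxE.
have [si|si] := boolP (i \in s); last first.
  rewrite sx// big1// => k _; rewrite !mxE.
  by case: eqP => [fi|]; rewrite ?mul0r//; move: si; rewrite fi enum_valP.
rewrite (bigD1 (enum_rank_in si i))//= big1 => [|k /negPf ki].
  by rewrite !mxE /f enum_rankK_in// eqxx mul1r addr0.
rewrite !mxE; case: eqP => [fi|]; rewrite ?mul0r//.
by move: ki; rewrite {2}fi enum_valK_in eqxx.
Qed.

Definition indep s := forall w, A *m w = 0 -> supported s w -> w = 0.

Definition is_basis s :=
  indep s /\ forall b, exists x, supported s x /\ A *m x = b.

Hypothesis A_ge0 : forall i j, 0 <= A i j.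
Hypothesis colA : forall j, col j A != 0.

(** Otherwise every product $A_{ij}w_j$ would vanish, although some $w_j$ and some entry of column
    $j$ are nonzero. This is what bounds the polytopes $P_b$. *)
Lemma kernel_lt0 w : A *m w = 0 -> w != 0 -> exists i, w i 0 < 0.
Proof.
move=> Aw w0; apply: contrapT => h.
have wge i : 0 <= w i 0 by rewrite leNgt; apply/negP => wi; apply: h; exists i.
have [j wj] : exists j, w j 0 != 0.
  apply: contrapT => h'; move/eqP: w0; apply; apply/colP => j; rewrite mxE.
  by apply: contrapT => wj; apply: h'; exists j; apply/eqP.
have [i Aij] : exists i, A i j != 0.
  apply: contrapT => h'; move/eqP: (colA j); apply; apply/colP => i; rewrite !mxE.
  by apply: contrapT => wi; apply: h'; exists i; apply/eqP.
have /eqP : (A *m w) i 0 = 0 by rewrite Aw mxE.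
rewrite mxE psumr_eq0 => [/allP/(_ j)|k _]; last exact: mulr_ge0.
by rewrite mem_index_enum mulf_eq0 (negPf Aij) (negPf wj) => /(_ isT).
Qed.

(* Moving along a dependency among the columns of the support, in the direction
   that does not decrease c, until a coordinate vanishes. *)
Lemma basic_reduction c b x : polytopeP A b x ->
  exists x', [/\ polytopeP A b x', indep (supp x') &
    (c *m x) 0 0 <= (c *m x') 0 0].
Proof.
have [k] := ubnP #|supp x|; elim: k x => // k IH x /ltnSE xk [x0 Ax].
have [ind|] := pselect (indep (supp x)); first by exists x.
rewrite /indep => /existsNP[w /not_implyP[Aw /not_implyP[sw /eqP w0]]].
have [{Aw sw w0}w [Aw sw w0 cw]] : exists w,
    [/\ A *m w = 0, supported (supp x) w, w != 0 & 0 <= (c *m w) 0 0].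
  have [cw|cw] := leP 0 ((c *m w) 0 0); first by exists w.
  exists (- w); split; first by rewrite mulmxN Aw oppr0.
  - by move=> i si; rewrite mxE sw ?oppr0.
  - by rewrite oppr_eq0.
  - by rewrite mulmxN mxE oppr_ge0 ltW.
have [i0 wi0] := kernel_lt0 Aw w0.
(* Ratio test: the least ratio is the step at which a coordinate first reaches zero, so $x'$ stays
   nonnegative and its support shrinks. *)
pose F i := x i 0 / - w i 0.
have [i /= wi Fmin] := arg_minP F (i0 := i0) (P := fun i => w i 0 < 0) wi0.
have F0 : 0 <= F i by rewrite divr_ge0 ?oppr_ge0 ?(ltW wi)//; exact: x0.
pose x' := x + F i *: w.
have x'E l : x' l 0 = x l 0 + F i * w l 0 by rewrite !mxE.
have xi : x i 0 != 0.
  apply/negP => /eqP xi; move: (sw i); rewrite inE xi eqxx => /(_ isT) wi'.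
  by move: wi; rewrite wi' ltxx.
have [||x'' [Px'' indx'' cx'']] := IH x'; last first.
- exists x''; split=> //; apply: le_trans cx''.
  by rewrite mulmxDr -scalemxAr [leRHS]mxE [X in _ + X]mxE lerDl mulr_ge0.
- split; last by rewrite mulmxDr -scalemxAr Aw scaler0 addr0.
  move=> l; rewrite x'E; have [wl|wl] := ltP (w l 0) 0; last first.
    by apply: addr_ge0; [exact: x0|exact: mulr_ge0].
  have := Fmin l wl; rewrite {2}/F ler_pdivlMr ?oppr_gt0// mulrN; lra.
apply: leq_trans xk; apply: proper_card; apply/properP; split.
  apply: supp_sub => l sl; rewrite x'E sw// mulr0 addr0.
  exact: supported_supp.
exists i; first by rewrite inE.
rewrite inE x'E negbK /F invrN mulrN mulNr -mulrA mulVf ?mulr1 ?subrr//.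
exact: ltr0_neq0.
Qed.

Definition basic_sol s b : 'cV[R]_n :=
  xget 0 [set x | supported s x /\ A *m x = b].

(** The direction of the edge along which the nonbasic coordinate $j$ enters. For a basis $s$, these
    vectors with $j\notin s$ form the basis of $\ker A$ dual to the coordinates outside $s$, and
    [c *m kvec s j] is the reduced cost of $j$. *)
Definition kvec s j : 'cV[R]_n := delta_mx j 0 - basic_sol s (col j A).

Section basis.
Context (s : {set 'I_n}) (bs : is_basis s).

Lemma basic_solP b : supported s (basic_sol s b) /\ A *m basic_sol s b = b.
Proof.
have [x Px] := bs.2 b.
by apply: (xgetPex 0 (P := [set x | supported s x /\ A *m x = b])); exists x.
Qed.

Lemma basic_sol_uniq b x : supported s x -> A *m x = b -> x = basic_sol s b.
Proof.
have [ss As] := basic_solP b => sx Ax; apply/eqP; rewrite -subr_eq0; apply/eqP.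
apply: bs.1; first by rewrite mulmxBr Ax As subrr.
by move=> i si; rewrite !mxE sx// ss// subrr.
Qed.

Lemma kvec_ker j : A *m kvec s j = 0.
Proof.
rewrite mulmxBr (basic_solP _).2 -colE subrr//.
Qed.

Lemma kvec_off i j : i \notin s -> kvec s j i 0 = (i == j)%:R.
Proof. by move=> si; rewrite !mxE (basic_solP _).1// subr0 andbT. Qed.

(** Both sides have the same entries outside $s$, and a kernel vector supported in $s$ is zero. *)
Lemma kernel_decomp w : A *m w = 0 -> w = \sum_(j | j \notin s) w j 0 *: kvec s j.
Proof.
move=> Aw; apply/eqP; rewrite -subr_eq0; apply/eqP; apply: bs.1.
  rewrite mulmxBr Aw sub0r mulmx_sumr big1 ?oppr0// => j _.
  by rewrite -scalemxAr kvec_ker scaler0.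
move=> i si; rewrite mxE mxE summxE (bigD1 i)//= mxE kvec_off// eqxx mulr1.
rewrite big1 => [|j /andP[_ ji]]; first by rewrite addr0 subrr.
by rewrite mxE kvec_off// eq_sym (negPf ji) mulr0.
Qed.

Lemma mul_kernel_decomp c w : A *m w = 0 ->
  (c *m w) 0 0 = \sum_(j | j \notin s) w j 0 * (c *m kvec s j) 0 0.
Proof.
move=> /kernel_decomp {1}->; rewrite mulmx_sumr summxE.
by apply: eq_bigr => j _; rewrite -scalemxAr mxE.
Qed.

End basis.

(** * The bases attached to a cell *)

Section chambers.
Hypothesis rankA : \rank A = d.
Context (C : set 'cV[R]_d) (cellC : cell A C).

(** Chambers involve nonempty $\sigma$ only, so a vertex with empty support, that is $b=0$, has to
    be avoided. If $C=C_0$, then $C$ lies in every $\mathrm{cone}(A_\sigma)$, so all its points have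
    the same chamber, and for $d>0$ one of them is nonzero. *)
Lemma chamber_witness : exists b,
  [/\ cone A b, C = chamber A b & b != 0 \/ d = 0%N].
Proof.
have [[b cb bC] [C0 [U dirU dimU]]] := cellC.
have [b0|bn0] := eqVneq b 0; last by exists b; split => //; left.
have [d0|d0] := eqVneq d 0%N; first by exists b; split=> //; right.
have n0 : (0 < n)%N by rewrite (leq_trans _ (rank_leq_col A))// rankA lt0n.
have cone0 s : cone (colset A s) 0.
  by apply/cone_colsetP; exists 0; split=> [i|i _|]; rewrite ?mxE// mulmx0.
have Csub s : s != finset.set0 -> C `<=` cone (colset A s).
  by move=> s0; rewrite -bC => b'; apply; split=> //; rewrite b0.
have [b' [Cb' b'0]] : exists b', C b' /\ b' != 0.
  apply: contrapT => h.
  have C0' (x : 'cV[R]_d) : C x -> x = 0.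
    by move=> Cx; apply/eqP; apply: contrapT => /negP x0; apply: h; exists x.
  have : (U <= 0)%VS.
    by apply/dirU => x y /C0' -> /C0' ->; rewrite subrr mem0v.
  by rewrite subv0 => /eqP U0; move: dimU; rewrite U0 dimv0 => /esym; apply/eqP.
exists b'; split; last by left.
  have /cone_colsetP[x [x0 _ Ax]] : cone (colset A [set: 'I_n]) b'.
    by apply: Csub => //; apply/set0Pn; exists (Ordinal n0); rewrite inE.
  by exists x.
rewrite -bC /chamber; congr (bigcap _ _).
apply/seteqP; split=> s [s0 _]; split=> //; first exact: Csub.
by rewrite b0.
Qed.

(** The span of the columns in $s$ contains $C$, hence its direction, which has dimension $d$. *)
Lemma spanning_of_cell s :
  (forall b, C b -> exists x, supported s x /\ A *m x = b) ->
  forall b, exists x, supported s x /\ A *m x = b.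
Proof.
move=> sC b; have [_ [_ [U dirU dimU]]] := cellC.
pose P : 'M[R]_n := diag_mx (\row_i (i \in s)%:R).
have PE (x : 'cV[R]_n) i : (P *m x) i 0 = (i \in s)%:R * x i 0.
  by rewrite mul_diag_mx !mxE.
pose V := limg (linfun (mulmx (A *m P) : 'cV[R]_n -> 'cV[R]_d)).
have CV b' : C b' -> b' \in V.
  move=> /sC[x [sx <-]]; apply/memv_imgP; exists x; first exact: memvf.
  rewrite lfunE/= -mulmxA; congr (_ *m _); apply/colP => i; rewrite PE.
  by case: (boolP (i \in s)) => [_|/sx ->]; rewrite ?mul1r ?mulr0.
have UV : (U <= V)%VS by apply/dirU => x y /CV Vx /CV Vy; exact: rpredB.
have UT : U = fullv.
  by apply/eqP; rewrite eqEdim subvf dimU dimvf/= /dim/= muln1.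
have : b \in V by apply: subvP UV _ _; rewrite UT memvf.
move=> /memv_imgP[x _ ->]; exists (P *m x); split; last by rewrite lfunE/= mulmxA.
by move=> i /negPf si; rewrite PE si mul0r.
Qed.

(* T consists of the supports of the vertices of P_b, for a point b whose
   chamber is C. As C is full-dimensional, these vertices are nondegenerate, so
   a vertex maximizing c has nonpositive reduced costs c *m kvec s j. *)
Lemma cell_bases : exists T : {set {set 'I_n}},
  [/\ forall s, s \in T -> is_basis s,
      forall s b, s \in T -> C b -> nonneg_orthant (basic_sol s b) &
      forall c, exists2 s, s \in T &
        forall j, j \notin s -> (c *m kvec s j) 0 0 <= 0].
Proof.
have [b [cb CE b0]] := chamber_witness.
pose T : {set {set 'I_n}} := [set s | `[< indep s /\
  exists x, polytopeP A b x /\ supp x = s >]]%SET.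
have Tcone s b' : s \in T -> C b' ->
    exists x, [/\ nonneg_orthant x, supported s x & A *m x = b'].
  rewrite inE => /asboolP[_ [x [[x0 Ax] sx]]] Cb'.
  (* An empty support forces $b=0$, hence $d=0$, and then the zero vector is a solution. *)
  have [s0|s0] := eqVneq s finset.set0.
    have bb : b = 0.
      rewrite -Ax (_ : x = 0) ?mulmx0//; apply/colP => i; rewrite mxE.
      by apply: supported_supp; rewrite sx s0 inE.
    case: b0 => [|d0]; first by rewrite bb eqxx.
    exists 0; split=> [i|i _|]; rewrite ?mxE//.
    by apply/colP => i; exfalso; have := ltn_ord i; rewrite [X in (_ < X)%N]d0.
  apply/cone_colsetP; move: Cb'; rewrite CE; apply; split=> //.
  by apply/cone_colsetP; exists x; split=> //; rewrite -sx; exact: supported_supp.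
have Tbasis s : s \in T -> is_basis s.
  move=> sT; split; first by move: sT; rewrite inE => /asboolP[].
  by apply: spanning_of_cell => b' /(Tcone _ _ sT)[x [_ ? ?]]; exists x.
exists T; split=> // [s b' sT Cb'|c].
  have [x [x0 sx Ax]] := Tcone _ _ sT Cb'.
  by rewrite -(basic_sol_uniq (Tbasis _ sT) sx Ax).
have red x : polytopeP A b x ->
    exists2 s, s \in T & (c *m x) 0 0 <= (c *m basic_sol s b) 0 0.
  move=> /(basic_reduction c)[x' [Px' ix' cx']].
  have sT : supp x' \in T by rewrite inE; apply/asboolP; split=> //; exists x'.
  exists (supp x') => //.
  by rewrite -(basic_sol_uniq (Tbasis _ sT) (supported_supp (x := x')) Px'.2).
have [x x0 Ax] := cb; have [s0 s0T _] := red x (conj x0 Ax).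
have [s sT0 smax] := arg_maxP (P := mem T) (fun s => (c *m basic_sol s b) 0 0) s0T.
have sT : s \in T := sT0.
exists s => // j sj; rewrite leNgt; apply/negP => cj.
have bs := Tbasis _ sT; have := sT; rewrite inE => /asboolP[_ [y [[y0 Ay] sy]]].
have ys : supported s y by rewrite -sy; exact: supported_supp.
(* The coordinates of $y$ in $s$ are positive, so a short step along [kvec s j] stays in $P_b$. With
   a positive reduced cost it would exceed the maximum over the vertices. *)
have [e e0 ey] := small_step y (kvec s j).
have [] := red (y + e *: kvec s j).
  split; last by rewrite mulmxDr Ay -scalemxAr kvec_ker// scaler0 addr0.
  move=> i; rewrite !mxE -[X in 0 <= _ + e * X](_ : kvec s j i 0 = _);
    last by rewrite !mxE.
  have [si|si] := boolP (i \in s).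
    apply/ltW/ey; rewrite lt_neqAle y0 andbT eq_sym.
    by move: si; rewrite -sy inE.
  rewrite ys// add0r kvec_off//; apply: mulr_ge0; first exact: ltW.
  by case: (_ == _).
move=> s' s'T; apply/negP; rewrite -ltNge.
apply: (le_lt_trans (smax s' s'T)).
rewrite -(basic_sol_uniq bs ys Ay) mulmxDr -scalemxAr [ltRHS]mxE ltrDl mxE.
exact: mulr_gt0.
Qed.

End chambers.

End lp.

(** * Facets *)

Lemma interior_line {R : realType} k (S : set 'cV[R]_k) (p v : 'cV[R]_k) :
  S° p -> exists2 e : R, 0 < e & S (p + e *: v).
Proof.
move=> /nbhs_ballP[r /= r0 rS].
pose M : R := \sum_i `|v i 0|.
have M0 : 0 <= M by apply: sumr_ge0.
have M1 : 0 < 1 + M by rewrite ltr_wpDr.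
exists (r / (1 + M)); first by rewrite divr_gt0.
apply: rS; split=> // i j; rewrite /ball/= !mxE ord1 opprD addrA subrr sub0r normrN.
rewrite normrM gtr0_norm ?divr_gt0// mulrAC ltr_pdivrMr// ltr_pM2l//.
rewrite (le_lt_trans (y := M))// ?ltrDr// /M (bigD1 i)//= lerDl.
exact: sumr_ge0.
Qed.

Lemma has_direction_uniq {R : realType} k (S : set 'cV[R]_k) U U' :
  has_direction S U -> has_direction S U' -> U = U'.
Proof.
move=> hU hU'; apply/eqP; rewrite eqEsubv; apply/andP; split.
- by apply/hU; apply/hU'.
- by apply/hU'; apply/hU.
Qed.

Section faces.
Context {R : realType} {d n : nat} (A : 'M[R]_(d, n)) (b : 'cV[R]_d).
Implicit Types (I s : {set 'I_n}) (c : 'rV[R]_n).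

Definition coord_face I : set 'cV[R]_n :=
  [set x | polytopeP A b x /\ forall i, i \in I -> x i 0 = 0].

Section one_basis.
Context s (bs : is_basis A s) (spos : forall i, i \in s -> 0 < basic_sol A s b i 0).

Lemma sol_polytope : polytopeP A b (basic_sol A s b).
Proof.
have [ss As] := basic_solP bs b; split=> //.
move=> i; have [/spos/ltW//|si] := boolP (i \in s).
by rewrite ss.
Qed.

Lemma sol_coord_face I : (forall i, i \in I -> i \notin s) ->
  coord_face I (basic_sol A s b).
Proof.
move=> Is; split; first exact: sol_polytope.
by move=> i iI; rewrite (basic_solP bs b).1// Is.
Qed.

Lemma coord_face_step I j :
  (forall i, i \in I -> i \notin s) -> j \notin s -> j \notin I ->
  exists2 e : R, 0 < e & coord_face I (basic_sol A s b + e *: kvec A s j).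
Proof.
move=> Is js jI; have [e e0 ep] := small_step (basic_sol A s b) (kvec A s j).
have xE i : (basic_sol A s b + e *: kvec A s j) i 0 =
    basic_sol A s b i 0 + e * kvec A s j i 0.
  by rewrite mxE [X in _ + X]mxE.
exists e => //; split; first split.
- move=> i; rewrite xE; have [/spos/ep/ltW//|si] := boolP (i \in s).
  by rewrite (basic_solP bs b).1// add0r kvec_off// mulr_ge0 ?(ltW e0).
- by rewrite mulmxDr (basic_solP bs b).2 -scalemxAr kvec_ker// scaler0 addr0.
- move=> i iI; have si : i \notin s by rewrite Is.
  rewrite xE (basic_solP bs b).1// add0r kvec_off//.
  by case: eqP => [ij|]; rewrite ?mulr0//; move: jI; rewrite -ij iI.
Qed.

(** The [kvec A s j] with $j$ outside $s$ and $I$ are a basis of the direction of the face: they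
    span all differences of its points, and each is a feasible direction at the vertex. *)
Lemma coord_face_dim I e : (forall i, i \in I -> i \notin s) ->
  has_dim (coord_face I) e <-> e = #|(~: s :\: I)%SET|.
Proof.
move=> Is; set J := (~: s :\: I)%SET.
pose X := [tuple kvec A s (enum_val i) | i < #|J|].
have XE (i : 'I_#|J|) : X`_i = kvec A s (enum_val i).
  by rewrite -tnth_nth tnth_mktuple.
have JP (i : 'I_#|J|) : enum_val i \notin s /\ enum_val i \notin I.
  by have := enum_valP i; rewrite !inE andbC => /andP[].
have freeX : free X.
  apply/freeP => k k0 i.
  have := congr1 (fun v : 'cV[R]_n => v (enum_val i) 0) k0.
  rewrite summxE mxE (bigD1 i)//=.
  rewrite mxE XE kvec_off ?(JP i).1// eqxx mulr1 big1 ?addr0// => l li.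
  rewrite mxE XE kvec_off ?(JP i).1//.
  by rewrite (inj_eq enum_val_inj) eq_sym (negPf li) mulr0.
have dirX : has_direction (coord_face I) <<X>>%VS.
  move=> V; split=> [XV x y [[_ Ax] xI] [[_ Ay] yI]|h].
    apply: (subvP XV); rewrite (kernel_decomp bs (w := x - y)); last first.
      by rewrite mulmxBr Ax Ay subrr.
    apply: rpred_sum => j js.
    have [jI|jI] := boolP (j \in I).
      by rewrite !mxE xI// yI// subrr scale0r mem0v.
    have jJ : j \in J by rewrite !inE jI js.
    rewrite rpredZ// -(enum_rankK_in jJ jJ) -XE.
    by apply: memv_span; apply: mem_nth; rewrite size_tuple.
  apply/span_subvP => u /tnthP[i ->]; rewrite (tnth_nth 0) XE.
  have [e' e0 he] := coord_face_step Is (JP i).1 (JP i).2.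
  have := h _ _ he (sol_coord_face Is); rewrite addrC addKr => /(memvZ e'^-1).
  by rewrite scalerA mulVf ?gt_eqF// scale1r.
have dimX : \dim <<X>> = #|J| by move: freeX; rewrite /free size_tuple => /eqP.
split=> [[_ [U dirU <-]]|->].
  by rewrite (has_direction_uniq dirU dirX).
split; first by exists (basic_sol A s b); exact: sol_coord_face.
by exists <<X>>%VS.
Qed.

(** Complementary slackness: $c$ at $x$ minus $c$ at the vertex is the sum of the $x_j$ times their
    reduced costs. All terms are nonpositive, so $x$ is optimal exactly when each term vanishes. *)
Lemma max_face_coord_face c : (forall j, j \notin s -> (c *m kvec A s j) 0 0 <= 0) ->
  [set x | polytopeP A b x /\
    forall x', polytopeP A b x' -> (c *m x') 0 0 <= (c *m x) 0 0] =
  coord_face [set j | (j \notin s) && ((c *m kvec A s j) 0 0 < 0)]%SET.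
Proof.
move=> cs; set v := basic_sol A s b.
have cE x : polytopeP A b x -> (c *m x) 0 0 - (c *m v) 0 0 =
    \sum_(j | j \notin s) x j 0 * (c *m kvec A s j) 0 0.
  move=> [x0 Ax].
  transitivity (\sum_(j | j \notin s) (x - v) j 0 * (c *m kvec A s j) 0 0).
    rewrite -mul_kernel_decomp// ?mulmxBr ?Ax ?(basic_solP bs b).2 ?subrr//.
    by rewrite [RHS]mxE; congr (_ + _); rewrite [RHS]mxE.
  by apply: eq_bigr => j js; rewrite !mxE (basic_solP bs b).1// subr0.
have Pv := sol_polytope.
have cx_le x : polytopeP A b x -> (c *m x) 0 0 <= (c *m v) 0 0.
  move=> Px; rewrite -subr_le0 cE// sumr_le0// => j js.
  by rewrite mulr_ge0_le0 ?cs//; exact: Px.1.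
apply/seteqP; split=> x [Px hx]; split=> //.
- have /eqP : \sum_(j | j \notin s) x j 0 * (c *m kvec A s j) 0 0 = 0.
    by rewrite -cE//; apply/eqP; rewrite subr_eq0 eq_le cx_le//= hx.
  move=> sum0 i; rewrite inE => /andP[si ci].
  have : \sum_(j | j \notin s) - (x j 0 * (c *m kvec A s j) 0 0) = 0.
    by rewrite sumrN; apply/eqP; rewrite oppr_eq0.
  move/eqP; rewrite psumr_eq0 => [/allP/(_ i)|j js]; last first.
    by rewrite oppr_ge0 mulr_ge0_le0 ?cs//; exact: Px.1.
  rewrite mem_index_enum si oppr_eq0 mulf_eq0 (lt_eqF ci) orbF/= => /(_ isT).
  by move/eqP.
- move=> x' /cx_le; suff -> : (c *m x) 0 0 = (c *m v) 0 0 by [].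
  apply/eqP; rewrite -subr_eq0 cE// big1// => j js.
  have := cs j js; rewrite le_eqVlt => /orP[/eqP ->|cj]; first by rewrite mulr0.
  by rewrite hx ?mul0r// inE js.
Qed.

End one_basis.

Context (T : {set {set 'I_n}}) (basisT : forall s, s \in T -> is_basis A s).
Hypothesis posT : forall s i, s \in T -> i \in s -> 0 < basic_sol A s b i 0.
Hypothesis dualT : forall c,
  exists2 s, s \in T & forall j, j \notin s -> (c *m kvec A s j) 0 0 <= 0.

(** These indices label the facets $\{x_i=0\}$ and the factors of the common denominator. *)
Definition nonbasic : {set 'I_n} := [set i | [exists s in T, i \notin s]]%SET.

Lemma nonbasicP i : reflect (exists2 s, s \in T & i \notin s) (i \in nonbasic).
Proof.
rewrite inE; apply: (iffP existsP) => [[s /andP[]]|[s sT si]]; exists s => //.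
by rewrite sT.
Qed.

Lemma polytope_dim s e : s \in T ->
  has_dim (polytopeP A b) e <-> e = #|(~: s)%SET|.
Proof.
move=> sT; have -> : polytopeP A b = coord_face finset.set0.
  by apply/seteqP; split=> x; [split=> // i; rewrite inE|case].
rewrite (coord_face_dim (basisT sT) (fun i => @posT s i sT)) => [|i];
  last by rewrite inE.
by rewrite finset.setD0.
Qed.

Lemma coord_face_facet i : i \in nonbasic ->
  facet (polytopeP A b) (coord_face [set i]%SET).
Proof.
move=> /nonbasicP[s sT si].
have [bs ps] := (basisT sT, fun i => @posT s i sT).
have is1 j : j \in [set i]%SET -> j \notin s by rewrite inE => /eqP ->.
have dP := polytope_dim _ sT; have dF := coord_face_dim bs ps _ is1.
split; last first.
  exists #|(~: s :\: [set i])%SET|; last exact/dF.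
  by apply/dP; rewrite [RHS](cardsD1 i) inE si.
(* The form $-x_i$ has maximum $0$ on the polytope, attained at the vertex of $s$ because $i\notin
   s$. *)
exists (- delta_mx 0 i); apply/seteqP; split=> x.
  move=> [Px xi]; split=> // x' Px'; rewrite !mulNmx -!rowE !mxE.
  by rewrite xi ?inE// oppr0 oppr_le0; exact: Px'.1.
move=> [Px hx]; split=> // j; rewrite inE => /eqP ->.
have := hx _ (sol_polytope bs ps); rewrite !mulNmx -!rowE !mxE (basic_solP bs b).1//.
by rewrite oppr0 oppr_ge0 => xi; apply/le_anti; rewrite xi Px.1.
Qed.

(** The codimension of the face maximizing $c$ is the number of negative reduced costs at an optimal
    vertex; for a facet there is exactly one. *)
Lemma facet_coord_face F : facet (polytopeP A b) F ->
  exists2 i, i \in nonbasic & F = coord_face [set i]%SET.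
Proof.
move=> [[c ->] [e dimP dimF]].
have [s sT cs] := dualT c.
have [bs ps] := (basisT sT, fun i => @posT s i sT).
move: dimF; rewrite (max_face_coord_face bs ps cs).
set I := (X in coord_face X).
have Is i : i \in I -> i \notin s by rewrite inE => /andP[].
move: dimP => /(polytope_dim _ sT) es /(coord_face_dim bs ps e Is).
rewrite cardsD (finset.setIidPr _); last first.
  by apply/fintype.subsetP => i /Is; rewrite inE.
move=> eI; have /cards1P[i Ii] : #|I| == 1%N.
  have : (#|I| <= #|(~: s)%SET|)%N.
    by apply: subset_leq_card; apply/fintype.subsetP => i /Is; rewrite inE.
  move: es eI; move: #|I| #|(~: s)%SET| => k l; lia.
exists i; last by rewrite Ii.
by apply/nonbasicP; exists s => //; apply: Is; rewrite Ii inE.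
Qed.

(** A vertex on $\{x_i=0\}$ either has $x_j>0$ already, or a step along [kvec A s j] makes $x_j$
    positive while keeping $x_i=0$. *)
Lemma coord_face_inj : {in nonbasic &, injective (fun i => coord_face [set i]%SET)}.
Proof.
move=> i j /nonbasicP[s sT si] _ ij; apply/eqP; apply: contrapT => /negP nij.
have [bs ps] := (basisT sT, fun i => @posT s i sT).
have is1 k : k \in [set i]%SET -> k \notin s by rewrite inE => /eqP ->.
have vj : coord_face [set j]%SET `<=` [set x | x j 0 = 0].
  by move=> x [_]; apply; rewrite inE.
have [js|js] := boolP (j \in s).
  have := vj (basic_sol A s b); rewrite -ij /= => /(_ (sol_coord_face bs ps is1)).
  by move/eqP; rewrite gt_eqF// posT.
have ji : j \notin [set i]%SET by rewrite inE eq_sym.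
have [e e0 he] := coord_face_step bs ps is1 js ji.
move: he; rewrite ij => /vj/=; rewrite mxE [X in _ + X]mxE (basic_solP bs b).1//.
by rewrite kvec_off// eqxx mulr1 add0r => /eqP; rewrite gt_eqF.
Qed.

Lemma nfacets_nonbasic N : has_nfacets (polytopeP A b) N -> N = #|nonbasic|.
Proof.
rewrite /has_nfacets => hN; apply/card_eq_II.
rewrite -(card_eql hN).
have -> : [set F | facet (polytopeP A b) F] =
    (fun k : 'I_#|nonbasic| => coord_face [set enum_val k]%SET) @` setT.
  apply/seteqP; split=> F /=.
    move=> /facet_coord_face[i iN ->]; exists (enum_rank_in iN i) => //.
    by rewrite enum_rankK_in.
  by move=> [k _ <-]; apply: coord_face_facet; exact: enum_valP.
rewrite (card_eql (inj_card_eq _)); last first.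
  move=> k l _ _ /coord_face_inj h; apply: enum_val_inj.
  by apply: h; exact: enum_valP.
by rewrite (card_eqr card_II).
Qed.

End faces.

(** * Products of linear forms *)

Section linear_forms.
Context {R : realType} {k n : nat} (N : 'M[R]_(n, k)).
Implicit Types (f g : mpoly k R) (i j : 'I_n) (w : 'cV[R]_k).

Definition mvar (j : 'I_k) : mpoly k R := mpolyX R (mnm1 j).

Definition mlin i : mpoly k R := \sum_j N i j *: mvar j.

Lemma meval_mlin i w : meval (w ^~ 0) (mlin i) = (N *m w) i 0.
Proof.
rewrite /mlin raddf_sum/= mxE; apply: eq_bigr => j _.
by rewrite mevalZ mevalXU.
Qed.

Lemma dhomog_mlin i : mlin i \is ishomog1 1 mdeg.
Proof.
apply: rpred_sum => j _; apply: rpredZ.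
by rewrite dhomogX; apply/eqP; exact: mdeg1.
Qed.

Lemma dhomog_prod_mlin (r : seq 'I_n) :
  \prod_(i <- r) mlin i \is ishomog1 (size r) mdeg.
Proof.
elim: r => [|i r IH]; first by rewrite big_nil; exact: dhomog1.
by rewrite big_cons -[size _]add1n dhomogM ?dhomog_mlin.
Qed.

Context (M : 'M[R]_(k, n)) (NM : N *m M = 1%:M).

Lemma mlin_neq0 i : mlin i != 0.
Proof.
apply/eqP => li; have := meval_mlin i (col i M).
rewrite li meval0 colE mulmxA NM mul1mx mxE !eqxx => /esym/eqP.
by rewrite oner_eq0.
Qed.

(* The projection onto the kernel of the i-th form along the i-th column of M:
   substituting it shows that mlin i is prime. *)
Definition kernel_proj i : k.-tuple (mpoly k R) :=
  [tuple mvar j - M j i *: mlin i | j < k].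

Lemma comp_kernel_proj_mlin i : comp_mpoly (kernel_proj i) (mlin i) = 0.
Proof.
rewrite {1}/mlin raddf_sum/=.
under eq_bigr => j _.
  rewrite comp_mpolyZ comp_mpolyXU -tnth_nth tnth_mktuple scalerBr scalerA.
  over.
rewrite sumrB -/(mlin i) -scaler_suml.
have -> : \sum_j N i j * M j i = (N *m M) i i by rewrite mxE.
by rewrite NM mxE eqxx scale1r subrr.
Qed.

(** The substitution is the identity modulo [mlin i]: this holds for the variables and passes to
    products and linear combinations. *)
Lemma comp_kernel_proj_sub i f :
  exists h, f - comp_mpoly (kernel_proj i) f = mlin i * h.
Proof.
pose D f := exists h, f - comp_mpoly (kernel_proj i) f = mlin i * h.
have DM f1 f2 : D f1 -> D f2 -> D (f1 * f2).
  move=> [h1 e1] [h2 e2]; exists (h1 * f2 + comp_mpoly (kernel_proj i) f1 * h2).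
  rewrite rmorphM/= mulrDr mulrA -e1 mulrCA -e2; ring.
have D1 : D 1 by exists 0; rewrite rmorph1 subrr mulr0.
have Dvar (j : 'I_k) : D (mvar j).
  exists (M j i *: 1).
  by rewrite comp_mpolyXU -tnth_nth tnth_mktuple opprB addrC subrK -scalerAr mulr1.
rewrite -/(D f); elim/mpolyind: f => [|c m p _ _ Dp].
  by exists 0; rewrite raddf0 subrr mulr0.
have DX : D (mpolyX R m).
  rewrite mpolyXE_id; apply: big_ind => // j _.
  by elim: (m j) => [//|l IH]; rewrite exprS; exact: (DM _ _ (Dvar j) IH).
have [h1 e1] := DX; have [h2 e2] := Dp.
exists (c *: h1 + h2).
by rewrite raddfD/= comp_mpolyZ opprD addrACA -scalerBr e1 e2 mulrDr scalerAr.
Qed.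

(** The substitution for the first form kills the product, hence $g$ or $q$. In the first case that
    form divides $g$; in the second it is cancelled from $q$ and the induction goes on. *)
Lemma dvd_prod_mlin g q (r : seq 'I_n) : g * q = \prod_(i <- r) mlin i ->
  g \is a GRing.unit \/ exists2 i, i \in r & exists h, g = mlin i * h.
Proof.
elim: r q => [|i r IH] q.
  by rewrite big_nil => gq; left; apply/unitrPr; exists q.
rewrite big_cons => gq.
have : comp_mpoly (kernel_proj i) g * comp_mpoly (kernel_proj i) q = 0.
  by rewrite -rmorphM/= gq rmorphM/= comp_kernel_proj_mlin mul0r.
move/eqP; rewrite mulf_eq0 => /orP[] /eqP zero.
  have [h] := comp_kernel_proj_sub i g; rewrite zero subr0 => gE.
  by right; exists i; [rewrite mem_head|exists h].
have [h] := comp_kernel_proj_sub i q; rewrite zero subr0 => qE.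
have : g * h = \prod_(j <- r) mlin j.
  by apply: (mulfI (mlin_neq0 i)); rewrite mulrCA -qE gq.
move/IH => [|[j jr [h' gE]]]; first by left.
by right; exists j; [rewrite inE jr orbT|exists h'].
Qed.

End linear_forms.

(** * The fraction, its degrees and its lowest terms *)

Section fraction.
Context {R : realType} {k n : nat} (N : 'M[R]_(n, k)) (M : 'M[R]_(k, n)).
Hypothesis NM : N *m M = 1%:M.
Context (T : {set {set 'I_n}}) (F : {set 'I_n}) (a : {set 'I_n} -> R) (m : nat).
Hypothesis T0 : exists s, s \in T.
Hypothesis a0 : forall s, s \in T -> 0 < a s.
Hypothesis FP : forall i, reflect (exists2 s, s \in T & i \notin s) (i \in F).
Hypothesis cardT : forall s, s \in T -> #|(~: s)%SET| = m.

(** Bringing $a_s/\prod_{i\notin s}x_i$ to the denominator $\prod_{i\in F}x_i$ leaves the factors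
    with $i\in F\cap s$, since the complement of $s$ lies in $F$. *)
Definition frac_num : mpoly k R :=
  \sum_(s in T) a s *: \prod_(i in (F :&: s)%SET) mlin N i.

Definition frac_den : mpoly k R := \prod_(i in F) mlin N i.

Lemma meval_frac_num (w : 'cV[R]_k) : meval (w ^~ 0) frac_num =
  \sum_(s in T) a s * \prod_(i in (F :&: s)%SET) (N *m w) i 0.
Proof.
rewrite /frac_num raddf_sum/=; apply: eq_bigr => s _; rewrite mevalZ rmorph_prod/=.
by congr (_ * _); apply: eq_bigr => i _; rewrite meval_mlin.
Qed.

Lemma meval_frac_den (w : 'cV[R]_k) :
  meval (w ^~ 0) frac_den = \prod_(i in F) (N *m w) i 0.
Proof.
by rewrite /frac_den rmorph_prod/=; apply: eq_bigr => i _; rewrite meval_mlin.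
Qed.

Lemma subset_nonbasic s : s \in T -> (~: s)%SET \subset F.
Proof.
by move=> sT; apply/fintype.subsetP => i; rewrite inE => si; apply/FP; exists s.
Qed.

Lemma card_nonbasicI s : s \in T -> #|(F :&: s)%SET| = (#|F| - m)%N.
Proof.
move=> sT; rewrite -(cardT sT).
have := cardsID s F; rewrite -(finset.setIidPr (subset_nonbasic sT)) finset.setDE.
lia.
Qed.

Lemma frac_num_homog : frac_num \is ishomog1 (#|F| - m) mdeg.
Proof.
apply: rpred_sum => s sT; apply: rpredZ; rewrite -(card_nonbasicI sT).
by rewrite -big_enum cardE; exact: dhomog_prod_mlin.
Qed.

Lemma frac_den_homog : frac_den \is ishomog1 #|F| mdeg.
Proof. by rewrite /frac_den -big_enum cardE; exact: dhomog_prod_mlin. Qed.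

Lemma frac_num_gt0 (w : 'cV[R]_k) : (forall i, 0 <= (N *m w) i 0) ->
  (exists2 s, s \in T & forall i, i \in s -> 0 < (N *m w) i 0) ->
  0 < meval (w ^~ 0) frac_num.
Proof.
move=> w0 [s sT ws]; rewrite meval_frac_num (bigD1 s)//=.
rewrite ltr_pwDl//.
  rewrite mulr_gt0 ?a0// prodr_gt0// => i; rewrite inE => /andP[_]; exact: ws.
apply: sumr_ge0 => t /andP[tT _]; rewrite mulr_ge0 ?(ltW (a0 tT))//.
exact: prodr_ge0.
Qed.

Lemma frac_coprime : mpoly_coprime frac_num frac_den.
Proof.
move=> g p' q' pE; rewrite /frac_den -big_enum => /esym/(dvd_prod_mlin NM).
move=> [//|[i]]; rewrite mem_enum => /FP[s sT si] [h gE].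
pose x : 'cV[R]_n := \col_j (j != i)%:R.
(* As [M] is a right inverse of [N], the forms take any prescribed values at a suitable point. *)
have NMx : N *m (M *m x) = x by rewrite mulmxA NM mul1mx.
have := @frac_num_gt0 (M *m x).
rewrite pE gE !mevalM meval_mlin NMx [X in X * _ * _]mxE eqxx !mul0r ltxx.
case/(_ _ _)/negP => //.
- by move=> j; rewrite mxE ler0n.
- exists s => // j js; rewrite mxE (_ : j != i) ?ltr01//.
  by apply: contraNneq si => <-.
Qed.

Lemma frac_num_neq0 : frac_num != 0.
Proof.
apply/eqP => p0; have := @frac_num_gt0 (M *m const_mx 1).
rewrite p0 meval0 ltxx mulmxA NM mul1mx.
case/(_ _ _)/negP => //; first by move=> i; rewrite mxE ler01.
by have [s sT] := T0; exists s => // i _; rewrite mxE.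
Qed.

Lemma frac_den_neq0 : frac_den != 0.
Proof. by apply/prodf_neq0 => i _; exact: (mlin_neq0 NM). Qed.

Lemma frac_evalE (w : 'cV[R]_k) : (forall i, 0 < (N *m w) i 0) ->
  meval (w ^~ 0) frac_den != 0 /\
  meval (w ^~ 0) frac_num / meval (w ^~ 0) frac_den =
  \sum_(s in T) a s / \prod_(i in (~: s)%SET) (N *m w) i 0.
Proof.
move=> w0; have pr0 (J : {set 'I_n}) : \prod_(i in J) (N *m w) i 0 != 0.
  by apply/prodf_neq0 => i _; rewrite gt_eqF.
rewrite meval_frac_den meval_frac_num; split; first exact: pr0.
rewrite mulr_suml; apply: eq_bigr => s sT.
rewrite -[X in _ / X](_ : \prod_(i in (F :&: s)%SET) (N *m w) i 0 *
  \prod_(i in (~: s)%SET) (N *m w) i 0 = _); first by field; rewrite !pr0.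
rewrite [RHS](bigID (mem s))/=; congr (_ * _); apply: eq_bigl => i; rewrite !inE//.
apply/idP/andP => [si|[]//]; split=> //; apply/FP; exists s => //.
Qed.

End fraction.

(** * The polar of Q_b - y *)

Lemma enum_setT_image n m (s : {set 'I_n}) : #|s| = m ->
  exists f : 'I_m -> 'I_n, injective f /\ (f @: [set: 'I_m] = s)%SET.
Proof.
move=> <-; exists enum_val; split; first exact: enum_val_inj.
apply/setP => i; apply/imsetP/idP => [[k _ ->]|si]; first exact: enum_valP.
by exists (enum_rank_in si i); rewrite ?inE// enum_rankK_in.
Qed.

Lemma sqr_norm_eq0 {R : realType} k (x : 'cV[R]_k) : (x^T *m x) 0 0 = 0 -> x = 0.
Proof.
rewrite mxE => /eqP; rewrite psumr_eq0 => [/allP h|i _]; last first.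
  by rewrite mxE -expr2 sqr_ge0.
apply/colP => i; have := h i; rewrite mem_index_enum !mxE => /(_ isT)/eqP/eqP.
by rewrite mulf_eq0 orbb => /eqP.
Qed.

Section coordinates.
Context {R : realType} {d n m : nat} (A : 'M[R]_(d, n)) (B : 'M[R]_(n, m)).
Hypothesis kerB : kernel_basis A B.
Hypothesis dimm : (d + m = n)%N.

Lemma kernel_basis_mul (z : 'cV[R]_m) : A *m (B *m z) = 0.
Proof. by apply/(kerB.2); exists z. Qed.

Lemma kernel_basis_inj (z : 'cV[R]_m) : B *m z = 0 -> z = 0.
Proof.
move=> Bz; apply/trmx_inj; rewrite trmx0; apply: (row_free_inj kerB.1).
by rewrite mul0mx -trmx_mul Bz trmx0.
Qed.

Lemma kernel_gram_eq0 (z : 'cV[R]_m) : B^T *m (B *m z) = 0 -> z = 0.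
Proof.
move=> Gz; apply: kernel_basis_inj; apply: sqr_norm_eq0.
by rewrite trmx_mul -mulmxA Gz mulmx0 mxE.
Qed.

Definition coord_mx : 'M[R]_(d + m, n) := col_mx A B^T.

Lemma coord_mx_inj (x : 'cV[R]_n) : coord_mx *m x = 0 -> x = 0.
Proof.
rewrite mul_col_mx -[0]vsubmxK => /eq_col_mx[].
rewrite !linear0 => /(kerB.2 x).1[z ->] /kernel_gram_eq0 ->.
by rewrite mulmx0.
Qed.

Lemma coord_mx_rank : \rank coord_mx = n.
Proof.
rewrite -mxrank_tr; apply/eqP; apply: inj_row_free => v vM.
apply/trmx_inj; rewrite trmx0; apply: coord_mx_inj.
by rewrite -[coord_mx]trmxK -trmx_mul vM trmx0.
Qed.

(** The true inverse once $d+m=n$; a pseudo-inverse is used because the two dimensions are not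
    convertible. *)
Definition coord_inv : 'M[R]_(n, d + m) := pinvmx coord_mx.

Lemma coord_invK : coord_inv *m coord_mx = 1%:M.
Proof. by apply: mulVpmx; rewrite /row_full coord_mx_rank. Qed.

Lemma coord_mxK : coord_mx *m coord_inv = 1%:M.
Proof. by apply: mulmxVp; rewrite /row_free coord_mx_rank dimm. Qed.

Lemma coord_invE (w : 'cV[R]_(d + m)) :
  A *m (coord_inv *m w) = usubmx w /\ B^T *m (coord_inv *m w) = dsubmx w.
Proof.
have := congr1 (fun M => M *m w) coord_mxK; rewrite mul1mx -mulmxA mul_col_mx => E.
by split; rewrite -[in RHS]E ?col_mxKu ?col_mxKd.
Qed.

(** The rows of $B$ outside $s$ form an invertible matrix. They are independent by pairing with the
    vectors [kvec]; its columns are, because a kernel vector vanishing outside $s$ is zero. *)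
Lemma basis_card s : is_basis A s -> #|(~: s)%SET| = m.
Proof.
move=> bs; have [f [finj fim]] := enum_setT_image (erefl #|(~: s)%SET|).
have fs k : f k \notin s.
  have : f k \in (~: s)%SET by rewrite -fim imset_f ?inE.
  by rewrite inE.
have rf : row_free (rowsub f B).
  apply: inj_row_free => u uG; apply/rowP => l; rewrite mxE.
  have [z kz] := (kerB.2 _).1 (kvec_ker bs (f l)).
  have : (u *m rowsub f (kvec A s (f l))) 0 0 = 0.
    by rewrite kz -mul_rowsub_mx mulmxA uG mul0mx mxE.
  rewrite mxE (bigD1 l)//= big1 => [|k kl].
    by rewrite addr0 mxE kvec_off// eqxx mulr1.
  by rewrite mxE kvec_off// (inj_eq finj) (negPf kl) mulr0.
rewrite -(eqP rf) -mxrank_tr; apply/eqP; apply: inj_row_free => v vG.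
apply/trmx_inj; rewrite trmx0; apply: kernel_basis_inj; apply: bs.1.
  exact: kernel_basis_mul.
move=> i si; have : i \in (f @: [set: 'I_(#|(~: s)%SET|)]%SET)%SET by rewrite fim inE.
move=> /imsetP[k _ ->].
have := congr1 (fun M : 'rV_ _ => M^T k 0) vG.
by rewrite trmx_mul trmxK mul_rowsub_mx !mxE.
Qed.

End coordinates.

Section polar.
Context {R : realType} {d n m : nat} (A : 'M[R]_(d, n)) (B : 'M[R]_(n, m)).
Hypothesis kerB : kernel_basis A B.

Section one_basis.
Context (s : {set 'I_n}) (bs : is_basis A s) (f : 'I_m -> 'I_n).
Hypotheses (finj : injective f) (fim : (f @: [set: 'I_m] = ~: s)%SET).

Lemma big_compl (V : Type) (idx : V) (op : Monoid.com_law idx) (h : 'I_n -> V) :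
  \big[op/idx]_(i | i \notin s) h i = \big[op/idx]_k h (f k).
Proof.
rewrite (eq_bigl (fun i => i \in (f @: [set: 'I_m]%SET)%SET)) => [|i];
  last by rewrite fim inE.
rewrite big_imset => [|k l _ _]; last exact: finj.
by apply: eq_bigl => k; rewrite inE.
Qed.

Lemma compl_notin k : f k \notin s.
Proof.
have : f k \in (~: s)%SET by rewrite -fim imset_f ?inE.
by rewrite inE.
Qed.

Lemma compl_onto j : j \notin s -> exists k, j = f k.
Proof.
move=> js; have : j \in (f @: [set: 'I_m]%SET)%SET by rewrite fim inE.
by move=> /imsetP[k _ ->]; exists k.
Qed.

(* The coordinates of z in the basis of the normal cone of Q_b at the vertex
   whose support is s. *)
Definition dual_coord_mx : 'M[R]_m :=
  - (B^T *m \matrix_(i, k) kvec A s (f k) i 0).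

(** The coordinates are the negated reduced costs of the objective $zB^T$, so they are nonnegative
    exactly when the optimality test at $s$ succeeds. *)
Lemma dual_coordE (z : 'rV[R]_m) k :
  (z *m dual_coord_mx) 0 k = - (z *m B^T *m kvec A s (f k)) 0 0.
Proof.
rewrite mulmxN mulmxA mxE [in LHS]mxE [in RHS]mxE; congr (- _).
by apply: eq_bigr => i _; congr (_ * _); rewrite mxE.
Qed.

(** If all coordinates of $z$ vanish, then $zB^T$ vanishes on $\ker A$, in particular at $Bz^T$,
    whose squared norm is therefore $0$. *)
Lemma dual_coord_unit : dual_coord_mx \in unitmx.
Proof.
rewrite -row_free_unit; apply: inj_row_free => z zL.
have zk k : (z *m B^T *m kvec A s (f k)) 0 0 = 0.
  by have := dual_coordE z k; rewrite zL mxE => /esym/eqP; rewrite oppr_eq0 => /eqP.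
apply/trmx_inj; rewrite trmx0; apply: (kernel_basis_inj kerB); apply: sqr_norm_eq0.
rewrite trmx_mul trmxK (mul_kernel_decomp bs); last exact: (kernel_basis_mul kerB).
by rewrite big1// => j /compl_onto[k ->]; rewrite zk mulr0.
Qed.

Lemma pairing_dual_coord b (x x' : 'cV[R]_n) (z : 'rV[R]_m) :
  A *m x = b -> A *m x' = b ->
  (z *m (B^T *m x' - B^T *m x)) 0 0 =
  \sum_k (z *m dual_coord_mx) 0 k * x (f k) 0 -
  \sum_k (z *m dual_coord_mx) 0 k * x' (f k) 0.
Proof.
move=> Ax Ax'; rewrite -mulmxBr mulmxA (mul_kernel_decomp bs); last first.
  by rewrite mulmxBr Ax Ax' subrr.
rewrite big_compl -sumrB; apply: eq_bigr => k _.
by rewrite dual_coordE mxE [X in _ + X]mxE; ring.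
Qed.

End one_basis.

Context (b : 'cV[R]_d) (T : {set {set 'I_n}}) (f : {set 'I_n} -> 'I_m -> 'I_n).
Hypothesis basisT : forall s, s \in T -> is_basis A s.
Hypothesis fT : forall s, s \in T ->
  injective (f s) /\ (f s @: [set: 'I_m] = ~: s)%SET.
Hypothesis dualT : forall c : 'rV[R]_n,
  exists2 s, s \in T & forall j, j \notin s -> (c *m kvec A s j) 0 0 <= 0.

Local Notation L s := (dual_coord_mx s (f s)).

(** For $z$ in the cone of $s$, the pairing with $y'-y$ is largest at the vertex of $s$, where the
    subtracted sum of [pairing_dual_coord] vanishes; the polar condition becomes one inequality.
    Vertices need only be nonnegative, which admits boundary points of $C$. *)
Lemma polar_atE (x : 'cV[R]_n) :
  (forall s, s \in T -> nonneg_orthant (basic_sol A s b)) -> A *m x = b ->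
  polar_at (polytopeQ A B b) (B^T *m x) = \bigcup_(s in [set` enum T])
    [set z | (forall k, 0 <= (z *m L s) 0 k) /\
             \sum_k (z *m L s) 0 k * (\row_k x (f s k) 0) 0 k <= 1].
Proof.
move=> posT Ax.
have sumE s z : \sum_k (z *m L s) 0 k * (\row_k x (f s k) 0) 0 k =
    \sum_k (z *m L s) 0 k * x (f s k) 0.
  by under eq_bigr do rewrite [X in _ * X]mxE.
apply/seteqP; split=> z; last first.
  move=> [s /= sT []]; rewrite mem_enum in sT.
  have [finj fim] := fT sT; rewrite sumE => z0 z1 _ [x' [x'0 Ax'] <-].
  rewrite (pairing_dual_coord (basisT sT) finj fim z Ax Ax').
  rewrite lerBlDr (le_trans z1)// lerDl.
  by apply: sumr_ge0 => k _; rewrite mulr_ge0.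
move=> /= hz; have [s sT sd] := dualT (z *m B^T); have [finj fim] := fT sT.
exists s; first by rewrite /= mem_enum.
split=> [k|]; first by rewrite dual_coordE oppr_ge0 sd// (compl_notin fim).
have [ss As] := basic_solP (basisT sT) b.
have := hz (B^T *m basic_sol A s b).
rewrite (pairing_dual_coord (basisT sT) finj fim z Ax As).
rewrite sumE [X in _ - X]big1 => [|k _];
  last by rewrite ss ?mulr0// (compl_notin fim).
rewrite subr0; apply; exists (basic_sol A s b) => //; split=> //.
exact: posT.
Qed.

(** For $z$ interior to both cones, the face maximizing $zB^T$ is cut out by $x_j=0$ for $j\notin
    s$, and likewise for $t$. Each vertex lies on it, so each of $s$ and $t$ contains the other. *)
Lemma dual_cones_disjoint s t (z : 'rV[R]_m) :
  (forall s i, s \in T -> i \in s -> 0 < basic_sol A s b i 0) ->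
  s \in T -> t \in T ->
  open_orthant (z *m L s) -> open_orthant (z *m L t) -> s = t.
Proof.
move=> posT sT tT zs zt.
have cT u : u \in T -> open_orthant (z *m L u) ->
    forall j, j \notin u -> (z *m B^T *m kvec A u j) 0 0 < 0.
  move=> uT zu j /(compl_onto (fT uT).2)[k ->].
  by have := zu k; rewrite dual_coordE oppr_gt0.
suff H u v : u \in T -> v \in T ->
    open_orthant (z *m L u) -> open_orthant (z *m L v) -> v \subset u.
  by apply/eqP; rewrite finset.eqEsubset !H.
move=> uT vT zu zv.
have face_le w : w \in T -> open_orthant (z *m L w) -> forall j, j \notin w ->
    (z *m B^T *m kvec A w j) 0 0 <= 0 by move=> wT zw j jw; apply/ltW/cT.
have := max_face_coord_face (basisT uT) (fun i => @posT u i uT) (face_le u uT zu).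
rewrite (max_face_coord_face (basisT vT) (fun i => @posT v i vT)
  (face_le v vT zv)) => E.
have : coord_face A b [set j | (j \notin v) && ((z *m B^T *m kvec A v j) 0 0 < 0)]%SET
    (basic_sol A v b).
  apply: (sol_coord_face (basisT vT) (fun i => @posT v i vT)) => i.
  by rewrite inE => /andP[].
rewrite E => -[_ h]; apply/fintype.subsetP => i iv; apply: contraT => iu.
have := h i; rewrite inE iu cT// => /(_ isT) v0.
by have := posT v i vT iv; rewrite v0 ltxx.
Qed.

End polar.

Lemma interior_slack_gt0 {R : realType} {d n m : nat} (A : 'M[R]_(d, n))
    (B : 'M[R]_(n, m)) (x : 'cV[R]_n) :
  kernel_basis A B -> pos A (A *m x) ->
  (polytopeQ A B (A *m x))° (B^T *m x) -> forall i, 0 < x i 0.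
Proof.
move=> kerB [x' x'0 Ax'] intQ i.
(* If row $i$ of $B$ is zero, $x_i$ is constant on the fibre of $A$ and equals the positive
   $x'_i$. *)
have [rB|rB] := eqVneq (row i B) 0.
  have /(kerB.2 _).1[z zE] : A *m (x - x') = 0 by rewrite mulmxBr Ax' subrr.
  have -> : x = x' + B *m z by rewrite -zE addrC subrK.
  rewrite mxE [X in _ + X](_ : _ = (row i B *m z) 0 0); last first.
    by rewrite -row_mul [RHS]mxE.
  by rewrite rB mul0mx [X in _ + X]mxE addr0; exact: x'0.
(* Along $v$ the coordinate $x_i$ decreases at the rate of the squared norm of row $i$ of $B$. A
   short step stays in $Q_b$, so $x_i$ can still decrease without becoming negative. *)
pose v := B *m - (row i B)^T.
have vi : v i 0 < 0.
  rewrite /v mulmxN mxE oppr_lt0 lt_neqAle eq_sym.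
  have viE : (B *m (row i B)^T) i 0 = (((row i B)^T)^T *m (row i B)^T) 0 0.
    by rewrite trmxK -row_mul [RHS]mxE.
  rewrite viE; apply/andP; split.
    apply: contra rB => /eqP/sqr_norm_eq0 h; apply/eqP/trmx_inj.
    by rewrite h trmx0.
  by rewrite mxE sumr_ge0// => j _; rewrite mxE -expr2 sqr_ge0.
have [e e0 [x'' [x''0 Ax''] Bx'']] := interior_line (B^T *m v) intQ.
have xE : x'' = x + e *: v.
  apply/eqP; rewrite -subr_eq0; apply/eqP; apply: (coord_mx_inj kerB).
  rewrite mul_col_mx !mulmxBr !mulmxDr -!scalemxAr Ax'' (kernel_basis_mul kerB).
  by rewrite Bx'' scaler0 addr0 !subrr col_mx0.
have := x''0 i; rewrite xE mxE [X in _ + X]mxE => h.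
have : e * v i 0 < 0 by rewrite pmulr_rlt0.
lra.
Qed.

(** * The rational formula on a cell *)

Theorem proposition2p5 (R : realType) (d n : nat)
  (A : 'M[R]_(d, n)) (B : 'M[R]_(n, n - d))
  (A_ge0 : forall i j, 0 <= A i j) (rankA : \rank A = d)
  (colA : forall j, col j A != 0) (kerB : kernel_basis A B)
  (C : set 'cV[R]_d) (cellC : cell A C)
  (b0 : 'cV[R]_d) (intb0 : C° b0)
  (nC : nat) (facetsC : has_nfacets (polytopeP A b0) nC) :
  exists2 e : nat, e%:Z = d%:Z - n%:Z + nC%:Z &
    homog_rational_on
      [set w : 'cV[R]_(d + (n - d)) |
        (C `&` pos A) (usubmx w) /\
        (polytopeQ A B (usubmx w))° (dsubmx w)]
      (fun w => vol (polar_at (polytopeQ A B (usubmx w)) (dsubmx w)))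
      e nC.
Proof.
have dn : (d <= n)%N by rewrite -rankA rank_leq_col.
have dimm : (d + (n - d))%N = n by rewrite subnKC.
have [T [basisT nonnegT dualT]] := cell_bases A_ge0 colA rankA cellC.
have cardT s : s \in T -> #|(~: s)%SET| = (n - d)%N.
  by move=> sT; exact: (basis_card kerB (basisT s sT)).
(* Subtracting a small multiple $e$ of column $i$ from $b_0$ stays in $C$ and lowers coordinate $i$
   of the basic solution by $e$; as the result is nonnegative, that coordinate was at least $e$. *)
have posT s i : s \in T -> i \in s -> 0 < basic_sol A s b0 i 0.
  move=> sT si; have bs := basisT s sT.
  have [e e0 Ce] := interior_line (- (A *m delta_mx i 0)) intb0.
  have [ss As] := basic_solP bs b0.
  have E : basic_sol A s b0 - e *: delta_mx i 0 =
      basic_sol A s (b0 + e *: - (A *m delta_mx i 0)).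
    apply: (basic_sol_uniq bs); last by rewrite mulmxBr As -scalemxAr scalerN.
    move=> j sj; rewrite !mxE ss// (_ : j == i = false) ?mulr0 ?subr0//.
    by apply: contraNF sj => /eqP ->.
  have := nonnegT _ _ sT Ce i; rewrite -E !mxE !eqxx mulr1 subr_ge0.
  exact: lt_le_trans.
have facet0 := nfacets_nonbasic basisT posT dualT facetsC.
have [s0 s0T _] := dualT 0; have T0 : exists s, s \in T by exists s0.
have /choice[f fT] : forall s, exists f : 'I_(n - d) -> 'I_n, s \in T ->
    injective f /\ (f @: [set: 'I_(n - d)] = ~: s)%SET.
  move=> s; have [sT|sT] := boolP (s \in T).
    by have [f fP] := enum_setT_image (cardT s sT); exists f.
  (* An arbitrary value outside [T]. *)
  by exists (fun k => widen_ord (leq_subr d n) k).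
pose F := nonbasic T.
pose L s := dual_coord_mx A B s (f s).
pose a s : R := fine (vol (@std_simplex R (n - d))) / `|\det (L s)|.
have uL s : s \in T -> L s \in unitmx.
  move=> sT; have [fi fm] := fT s sT.
  exact: (dual_coord_unit kerB (basisT s sT) fm).
have a0 s : s \in T -> 0 < a s.
  move=> sT; rewrite divr_gt0//; last by rewrite normr_gt0 -unitfE -unitmxE uL.
  by rewrite fine_gt0// vol_std_simplex_gt0 vol_std_simplex_fin.
have FP i : reflect (exists2 s, s \in T & i \notin s) (i \in F) by exact: nonbasicP.
have NM := coord_invK kerB.
(* The truncated subtraction is exact: [F] contains the complement of [s0], which has $n-d$
   elements. *)
exists (#|F| - (n - d))%N.
  have := subset_leq_card (subset_nonbasic FP s0T); rewrite cardT// facet0 -/F.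
  lia.
exists (frac_num (coord_inv A B) T F a), (frac_den (coord_inv A B) F); split.
- split; first exact: (frac_num_neq0 NM (T := T)).
  exact: (frac_num_homog _ _ FP cardT).
- by rewrite facet0; split; [exact: (frac_den_neq0 NM)|exact: frac_den_homog].
- exact: (frac_coprime NM a0 FP).
move=> w [[Cw posw] intw].
have [Ax Bx] := coord_invE kerB dimm w.
set x := coord_inv A B *m w in Ax Bx.
have x0 : forall i, 0 < x i 0.
  by apply: (interior_slack_gt0 kerB); rewrite Ax// Bx.
have [den0 ->] := frac_evalE a FP x0.
split=> //.
rewrite -Bx (polar_atE B basisT fT dualT (fun s sT => nonnegT s _ sT Cw) Ax).
rewrite (vol_simplicial_cover (r := enum T) (L := L)
  (x := fun s => \row_k x (f s k) 0) _ _ _ (erefl _)).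
- congr EFin; rewrite big_enum; apply: eq_bigr => s sT.
  have [fi fm] := fT s sT.
  rewrite /a invfM mulrA; congr (_ / _).
  under eq_bigr do rewrite mxE.
  rewrite -(big_compl fi fm _ (fun i => x i 0)).
  by apply: eq_bigl => i; rewrite inE.
- exact: enum_uniq.
- by move=> s; rewrite mem_enum; exact: uL.
- by move=> s _ k; rewrite mxE.
(* The cones do not depend on $b$, so their interiors may be separated at $b_0$, where the vertices
   are nondegenerate. *)
- move=> s t z; rewrite !mem_enum => sT tT.
  exact: (dual_cones_disjoint basisT fT posT sT tT).
Qed.
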